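(* Suppose the noise $\varepsilon$ is normal with mean $0$ and variance $0<\sigma^2<\infty$. (i) For $0<q\le1$, under Assumption SRC with $\gamma=m_*$, $$\inf_{\hat f}\sup_{f_0\in\mathcal{F}_q(t_n;M_n)}E\|\hat f-f_0\|^2\ge c\,\underline\Psi^{\mathcal{F}_q^L(t_n;M_n)}.$$ (ii) Under Assumption SRC with $\gamma=k_n$, $$\inf_{\hat f}\sup_{f_0\in\mathcal{F}_0(k_n;M_n)\cap\{f_\theta:\|\theta\|_2\le a_n\}}E\|\hat f-f_0\|^2\ge c'\begin{cases}\underline\Psi^{\mathcal{F}_0^L(k_n;M_n)}&\text{if }a_n\ge\tilde c\,\sigma\sqrt{\frac{k_n(1+\log\frac{M_n}{k_n})}{n}},\\ a_n^2&\text{if }a_n<\tilde c\,\sigma\sqrt{\frac{k_n(1+\log\frac{M_n}{k_n})}{n}},\end{cases}$$ where $\tilde c$ is a pure constant. (iii) For any $0<q\le1$, under Assumption SRC with $\gamma=k_n\wedge m_*$, $$\inf_{\hat f}\sup_{f_0\in\mathcal{F}_0(k_n;M_n)\cap\mathcal{F}_q(t_n;M_n)}E\|\hat f-f_0\|^2\ge c''\,\underline\Psi^{\mathcal{F}_q^L(t_n;M_n)\cap\mathcal{F}_0^L(k_n;M_n)}.$$ In all cases $\hat f$ ranges over all estimators, and the (positive) constants $c,c',c''$ may depend on $\underline a,\overline a,q$ and $\sigma^2$.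
   Context: $n\ge2$, $M_n\ge2$. Data $(\mathbf{X}_i,Y_i)_{i=1}^n$ are i.i.d. copies of $(\mathbf{X},Y)$ with $\mathbf{X}=(X_1,\ldots,X_{M_n})\sim P_X$, $Y=f_0(\mathbf{X})+\varepsilon$, $\varepsilon$ independent of $\mathbf{X}$. $\|\cdot\|$ applied to functions is the $L_2(P_X)$ norm. $f_\theta(\mathbf{x})=\sum_{j=1}^{M_n}\theta_jx_j$; $\|\theta\|_0$ is the number of nonzero components, $\|\theta\|_q=(\sum|\theta_j|^q)^{1/q}$, $\|\theta\|_2$ the Euclidean norm. $\mathcal{F}_q(t_n;M_n)=\{f_\theta:\|\theta\|_q\le t_n\}$ ($0<q\le1$, $t_n>0$); $\mathcal{F}_0(k_n;M_n)=\{f_\theta:\|\theta\|_0\le k_n\}$ ($1\le k_n\le M_n$ integer); $a_n>0$. Assumption SRC (with parameter $\gamma>0$): there exist two positive constants $\underline a$ and $\overline a$ not depending on $n$ such that for every $\theta$ with $\|\theta\|_0\le\min(2\gamma,M_n)$, $\underline a\|\theta\|_2\le\|f_\theta\|\le\overline a\|\theta\|_2$. $\tau=\sigma^{-2}$; $m^*=\lceil(nt_n^2\tau)^{q/2}\rceil\wedge M_n\wedge n$; $m_*=m^*$ if $m^*=M_n\wedge n$, otherwise $m_*=\lceil m^*/(1+\log(M_n/m^* ))^{q/2}\rceil$. $$\underline\Psi^{\mathcal{F}_q^L(t_n;M_n)}=\begin{cases}\sigma^2&\text{if }m_*=n,\\ \frac{\sigma^2M_n}{n}&\text{if }m_*=M_n<n,\\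 \sigma^{2-q}t_n^q\Bigl(\frac{1+\log\frac{M_n}{(nt_n^2\tau)^{q/2}}}{n}\Bigr)^{1-q/2}\wedge\sigma^2&\text{if }1<m_*<M_n\wedge n,\\ \sigma^2\wedge t_n^2&\text{if }m_*=1,\end{cases}$$ $\underline\Psi^{\mathcal{F}_0^L(k_n;M_n)}=\sigma^2\Bigl(1\wedge\frac{k_n(1+\log(M_n/k_n))}{n}\Bigr)$, $\underline\Psi^{\mathcal{F}_q^L(t_n;M_n)\cap\mathcal{F}_0^L(k_n;M_n)}=\underline\Psi^{\mathcal{F}_q^L(t_n;M_n)}\wedge\underline\Psi^{\mathcal{F}_0^L(k_n;M_n)}$. (The superscript $L$ is only notation; these quantities do not involve $L$.) *)

(* Defs.v *)
From HB Require Import structures.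
From mathcomp Require Import all_boot all_order all_algebra.
From mathcomp Require Import all_classical all_reals all_analysis.

Set Implicit Arguments.
Unset Strict Implicit.
Unset Printing Implicit Defensive.

Import Order.TTheory GRing.Theory Num.Theory.
Import numFieldNormedType.Exports.

Local Open Scope classical_set_scope.
Local Open Scope ring_scope.

Section parameters.
Context {R : realType} {M : nat}.
Implicit Types (theta : 'rV[R]_M) (q t a : R) (k : nat).

(* Parameters are row vectors; covariate vectors are tuples, because tuples
   (and not matrices) carry the product sigma-algebra. *)
Definition linear_fun theta (x : M.-tuple R) : R :=
  \sum_(j < M) theta ord0 j * tnth x j.

Definition l0norm theta : nat := #|[pred j | theta ord0 j != 0]|.

Definition lqnorm q theta : R :=
  (\sum_(j < M) `|theta ord0 j| `^ q) `^ q^-1.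

Definition l2norm theta : R := Num.sqrt (\sum_(j < M) theta ord0 j ^+ 2).

Definition lq_class q t : set (M.-tuple R -> R) :=
  [set linear_fun theta | theta in [set theta | lqnorm q theta <= t]].

Definition l0_class k : set (M.-tuple R -> R) :=
  [set linear_fun theta | theta in [set theta | (l0norm theta <= k)%N]].

Definition l2_class a : set (M.-tuple R -> R) :=
  [set linear_fun theta | theta in [set theta | l2norm theta <= a]].

Definition L2norm (PX : probability (M.-tuple R) R) (f : M.-tuple R -> R)
  : \bar R := ('N[PX]_(2%:E)[EFin \o f])%E.

(* SRC = sparse Riesz condition. *)
Definition SRC (PX : probability (M.-tuple R) R) (alo ahi : R) (gamma : nat)
  : Prop :=
  forall theta, (l0norm theta <= minn (2 * gamma) M)%N ->
    ((alo * l2norm theta)%:E <= L2norm PX (linear_fun theta))%E /\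
    (L2norm PX (linear_fun theta) <= (ahi * l2norm theta)%:E)%E.

End parameters.

Definition independent_rvs {d d' d''} {Omega : measurableType d}
    {T : measurableType d'} {U : measurableType d''} {R : realType}
    (P : probability Omega R) (X : Omega -> T) (Y : Omega -> U) : Prop :=
  forall A B, measurable A -> measurable B ->
    P (X @^-1` A `&` Y @^-1` B) = (P (X @^-1` A) * P (Y @^-1` B))%E.

Definition mutually_independent {d d'} {Omega : measurableType d}
    {T : measurableType d'} {R : realType} (P : probability Omega R) {n : nat}
    (Z : 'I_n -> Omega -> T) : Prop :=
  forall (J : {set 'I_n}) (A : 'I_n -> set T), (forall i, measurable (A i)) ->
    P (\bigcap_(i in [set` J]) Z i @^-1` A i) =
    (\prod_(i in J) P (Z i @^-1` A i))%E.

(* The design does not depend on f0: for every f0 the responses are defined as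
   Y i = f0 (X i) + eps i in [sample], so that the (X i, Y i) are i.i.d. copies
   of (X, f0 X + eps).  [normal_prob] takes the standard deviation. *)
Record regression_design {d} {Omega : measurableType d} {R : realType}
    (P : probability Omega R) {n M : nat} (PX : probability (M.-tuple R) R)
    (sigma : R) (X : 'I_n -> {RV P >-> M.-tuple R}) (eps : 'I_n -> {RV P >-> R})
  : Prop := RegressionDesign {
  design_lawX : forall i A, measurable A -> distribution P (X i) A = PX A ;
  design_law_eps : forall i B, measurable B ->
    distribution P (eps i) B = normal_prob 0 sigma B ;
  design_indep_eps : forall i, independent_rvs P (X i) (eps i) ;
  design_indep_pairs : mutually_independent P (fun i w => (X i w, eps i w)) }.

Section minimax.
Context {d} {Omega : measurableType d} {R : realType} (P : probability Omega R).
Context {n M : nat} (PX : probability (M.-tuple R) R).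
Variables (X : 'I_n -> {RV P >-> M.-tuple R}) (eps : 'I_n -> {RV P >-> R}).

Definition sample (f0 : M.-tuple R -> R) (w : Omega)
  : n.-tuple (M.-tuple R * R) :=
  [tuple (X i w, f0 (X i w) + eps i w) | i < n].

(* An estimator maps the data to a function of the covariates; measurability is
   joint in the data and the evaluation point. *)
Definition estimator : set (n.-tuple (M.-tuple R * R) -> M.-tuple R -> R) :=
  [set fhat | measurable_fun setT
    (fun z : n.-tuple (M.-tuple R * R) * M.-tuple R => fhat z.1 z.2)].

Definition risk (fhat : n.-tuple (M.-tuple R * R) -> M.-tuple R -> R)
    (f0 : M.-tuple R -> R) : \bar R :=
  (\int[P]_w (L2norm PX (fun x => (fhat (sample f0 w) x - f0 x)%R) ^+ 2))%E.

Definition minimax_risk (F : set (M.-tuple R -> R)) : \bar R :=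
  ereal_inf [set ereal_sup [set risk fhat f0 | f0 in F] | fhat in estimator].

End minimax.

Section rates.
Context {R : realType}.
Variables (n M : nat) (sigma : R).

Definition eff_size (q t : R) : R := (n%:R * t ^+ 2 * sigma ^- 2) `^ (q / 2).

Definition m_upper (q t : R) : nat :=
  minn (minn `|Num.ceil (eff_size q t)|%N M) n.

Definition m_lower (q t : R) : nat :=
  let m := m_upper q t in
  if m == minn M n then m
  else `|Num.ceil (m%:R / (1 + ln (M%:R / m%:R)) `^ (q / 2))|%N.

(* The last branch is the case [m_lower q t = 1]: for n, M >= 2 the four cases
   are disjoint and exhaustive. *)
Definition rate_lq (q t : R) : R :=
  let m := m_lower q t in
  if m == n then sigma ^+ 2
  else if (m == M) && (M < n)%N then sigma ^+ 2 * M%:R / n%:R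
  else if (1 < m < minn M n)%N then
    Num.min (sigma `^ (2 - q) * t `^ q *
             ((1 + ln (M%:R / eff_size q t)) / n%:R) `^ (1 - q / 2))
            (sigma ^+ 2)
  else Num.min (sigma ^+ 2) (t ^+ 2).

Definition sparse_rate (k : nat) : R :=
  k%:R * (1 + ln (M%:R / k%:R)) / n%:R.

Definition rate_l0 (k : nat) : R := sigma ^+ 2 * Num.min 1 (sparse_rate k).

Definition rate_lq_l0 (q t : R) (k : nat) : R :=
  Num.min (rate_lq q t) (rate_l0 k).

End rates.

(* Main.v *)
Require Import Defs.
From HB Require Import structures.
From mathcomp Require Import all_boot all_order all_algebra.
From mathcomp Require Import all_classical all_reals all_analysis.
From mathcomp Require Import measurable_realfun.
From mathcomp Require Import ring lra zify.

(** The lower bounds come from a finite family of sparse regression functions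
    that the data cannot tell apart.  Take [K] disjoint blocks of [B]
    coordinates, with [K] of the order of the sparsity [k] and [B] of the order
    of [M / k], and put in each block a single coefficient [alpha], at a
    position chosen freely.  A choice of positions is a map [v] from blocks to
    positions inside a block, and [f_v] is the corresponding linear function.

    Estimating [f_v] is at least as hard as guessing [v].  The difference of two
    hypotheses is [2K]-sparse, so the sparse Riesz condition bounds the squared
    L2 distance of [f_u] and [f_v] below by [alo ^ 2 * alpha ^ 2] times the
    number of blocks in which [u] and [v] disagree.  Replacing an estimator by
    the hypothesis nearest to it costs a factor 4 ([risk_ge_test_error]).

    Inside one block the position is hidden.  Erasing the coefficient of block
    [b] changes the regression function by [alpha] times one covariate, hence
    the law of the sample by an explicit Gaussian likelihood ratio.  Its second
    moment may be infinite, since no exponential moment of the design is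
    assumed.  It is finite after truncation to the event that the empirical
    energy of the shift is small, and the second moment of the covariate
    controls the probability of the complement ([sample_shift_prob_le]).  Once the block is
    erased nothing in the data depends on the position, so a guess is right for
    one position out of [B] on average ([sum_guess_le]).  Altogether, if
    [n * ahi ^ 2 * alpha ^ 2 <= sigma ^ 2 * ln B / 40], then every test is wrong,
    for some [v], in at least a tenth of the blocks on average ([block_minimax_lower]), which gives a
    risk of order [alpha ^ 2 * k].

    The level [alpha] is limited by this condition, that is
    [alpha ^ 2 <= c * sigma ^ 2 * (1 + ln (M / k)) / n], and by the class of
    functions: [alpha <= rho] with [rho = a / sqrt k] for an l2 ball and
    [rho = t / k ^ (1 / q)] for an lq ball.  The largest admissible level gives
    a bound of order [min (sigma ^ 2 * sparse_rate k, k * rho ^ 2)]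
    ([sparse_minimax_lower]).  For the lq ball, the effective sparsity
    [m_lower] balances the two terms so that both dominate [rate_lq] there
    ([rate_lq_le]), and below it the second term only grows
    ([radius_sqr_le]). *)

Set Implicit Arguments.
Unset Strict Implicit.
Unset Printing Implicit Defensive.

Import Order.TTheory GRing.Theory Num.Theory.
Import numFieldNormedType.Exports.

Local Open Scope classical_set_scope.
Local Open Scope ring_scope.

(** * Products of functions of independent variables *)

(** An identity between integrals extends from indicators to nonnegative
    functions: write [h z] as the Lebesgue measure of [[0, h z[] and exchange
    the integrals.  Used with [H] a product of functions of the other
    variables (independence), and with [H] a density (change of measure). *)
Lemma integral_layer_cake {d1 d2 d'} {Omega1 : measurableType d1}
    {Omega2 : measurableType d2} {T : measurableType d'} {R : realType}
    (mu1 : {sigma_finite_measure set Omega1 -> \bar R})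
    (mu2 : {sigma_finite_measure set Omega2 -> \bar R})
    (Z1 : Omega1 -> T) (Z2 : Omega2 -> T) (H : Omega1 -> R) (c : \bar R)
    (h : T -> R) :
  measurable_fun setT Z1 -> measurable_fun setT Z2 ->
  measurable_fun setT H -> (forall w, 0 <= H w) -> (0 <= c)%E ->
  (forall A, measurable A ->
    (\int[mu1]_w ((\1_A (Z1 w) : R) * H w)%:E =
     c * \int[mu2]_w ((\1_A (Z2 w) : R))%:E)%E) ->
  measurable_fun setT h -> (forall z, 0 <= h z) ->
  (\int[mu1]_w (h (Z1 w) * H w)%:E = c * \int[mu2]_w (h (Z2 w))%:E)%E.
Proof.
move=> mZ1 mZ2 mH H0 c0 muE mh h0.
pose leb := @lebesgue_measure R.
pose A (t : R) : set T := [set z | 0 <= t < h z].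
have mA t : measurable (A t).
  have -> : A t = [set z | 0 <= t] `&` (h @^-1` `]t, +oo[).
    by apply/seteqP; split => z /=; rewrite /A /= in_itv /= andbT => /andP.
  apply: measurableI; first by case: (0 <= t); [rewrite set_true|rewrite set_false].
  by rewrite -[X in measurable X]setTI; exact: mh.
pose S (Omega : Type) (Z : Omega -> T) : set (Omega * R) :=
  [set wt | A wt.2 (Z wt.1)].
have mS d (Omega : measurableType d) (Z : Omega -> T) :
    measurable_fun setT Z -> measurable (S _ Z).
  move=> mZ.
  have -> : S _ Z = (snd @^-1` `[0, +oo[) `&`
      ((fun wt : Omega * R => h (Z wt.1) - wt.2) @^-1` `]0, +oo[).
    apply/seteqP; split => -[w t] /=;
      by rewrite /S /A /= !in_itv /= !andbT subr_gt0 => /andP.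
  apply: measurableI.
    by rewrite -[X in measurable X]setTI; apply: measurable_snd.
  rewrite -[X in measurable X]setTI.
  have mf : measurable_fun setT (fun wt : Omega * R => h (Z wt.1) - wt.2).
    apply: measurable_funB => //.
    by apply: (measurableT_comp mh); apply: measurableT_comp.
  exact: mf.
have slice (z : T) : (\int[leb]_t ((\1_(A t) z : R))%:E = (h z)%:E)%E.
  transitivity (\int[leb]_t ((\1_(`[0, h z[ : set R) t : R))%:E)%E.
    by apply: eq_integral.
  rewrite integral_indic//= setIT /leb lebesgue_measure_itv /=.
  by rewrite lte_fin; case: ltP (h0 z) => [_ _|h1 h2]; rewrite ?sube0//;
    congr EFin; apply/le_anti/andP.
have indS (Omega : Type) (Z : Omega -> T) w t :
    (\1_(S _ Z) (w, t) : R) = \1_(A t) (Z w) by [].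
pose F (wt : Omega1 * R) : \bar R := ((\1_(S _ Z1) wt : R) * H wt.1)%:E.
have mF : measurable_fun setT F.
  apply/measurable_EFinP; apply: measurable_funM; last exact: measurableT_comp.
  by apply: measurable_indic; exact: mS.
have F0 wt : (0 <= F wt)%E by rewrite lee_fin mulr_ge0.
have lhs : (\int[mu1]_w (h (Z1 w) * H w)%:E =
            \int[mu1]_w \int[leb]_t F (w, t))%E.
  apply: eq_integral => w _; rewrite /F /=.
  under eq_integral do rewrite indS EFinM.
  rewrite ge0_integralZr//; [by rewrite slice| |by rewrite lee_fin].
  under eq_fun do rewrite -indS.
  apply/measurable_EFinP.
  have mI : measurable_fun setT (\1_(S _ Z1) : _ -> R).
    by apply: measurable_indic; exact: mS.
  apply: (measurableT_comp mI).
  exact: pair1_measurable.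
rewrite lhs fubini_tonelli//.
pose G (wt : Omega2 * R) : \bar R := ((\1_(S _ Z2) wt : R))%:E.
have mG : measurable_fun setT G.
  by apply/measurable_EFinP; apply: measurable_indic; exact: mS.
have G0 wt : (0 <= G wt)%E by rewrite lee_fin.
have rhs : (\int[mu2]_w (h (Z2 w))%:E = \int[mu2]_w \int[leb]_t G (w, t))%E.
  apply: eq_integral => w _; rewrite /G /=.
  by under eq_integral do rewrite indS; rewrite slice.
rewrite rhs fubini_tonelli// -ge0_integralZl//; first last.
- by move=> t _; apply: integral_ge0.
- exact: measurable_fun_fubini_tonelli_G.
apply: eq_integral => t _; rewrite /F /G.
under eq_integral do rewrite indS.
under [in RHS]eq_integral do rewrite indS.
exact: muE.
Qed.

(** Independence is given on events, that is for products of indicators.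
    Indicators are replaced by general functions one index at a time: the
    remaining product plays the role of the weight [H] of
    [integral_layer_cake]. *)
Lemma expectation_prod_indep {d d'} {Omega : measurableType d}
    {T : measurableType d'} {R : realType} (P : probability Omega R) (n : nat)
    (Z : 'I_n -> Omega -> T) (h : 'I_n -> T -> R) :
  (forall i, measurable_fun setT (Z i)) -> mutually_independent P Z ->
  (forall i, measurable_fun setT (h i)) -> (forall i z, 0 <= h i z) ->
  (\int[P]_w (\prod_(i < n) h i (Z i w))%:E =
   \prod_(i < n) \int[P]_w (h i (Z i w))%:E)%E.
Proof.
move=> mZ indepZ mh h0.
have mI (A : set T) : measurable A -> measurable_fun setT (\1_A : T -> R).
  by move=> mA; exact: measurable_indic.
suff main k : (k <= n)%N -> forall h : 'I_n -> T -> R,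
    (forall i, measurable_fun setT (h i)) -> (forall i z, 0 <= h i z) ->
    (forall i : 'I_n, (k <= i)%N -> exists2 A, measurable A & h i = \1_A) ->
    (\int[P]_w (\prod_(i < n) h i (Z i w))%:E =
     \prod_(i < n) \int[P]_w (h i (Z i w))%:E)%E.
  by apply: (main n) => // i; rewrite leqNgt ltn_ord.
elim: k {h mh h0} => [_ h mh h0 hI|k IH kn h mh h0 hI].
  have /choice[A AE] : forall i, exists A, measurable A /\ h i = \1_A.
    by move=> i; have [A mA hA] := hI i (leq0n i); exists A.
  have mA i : measurable (A i) by have [] := AE i.
  have hE i : h i = \1_(A i) by have [] := AE i.
  have mZA i : measurable (Z i @^-1` A i).
    by rewrite -[X in measurable X]setTI; exact: mZ.
  transitivity (P (\bigcap_(i in [set` [set: 'I_n]%SET]) Z i @^-1` A i)).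
    have mcap : measurable (\bigcap_(i in [set` [set: 'I_n]%SET]) Z i @^-1` A i).
      by apply: fin_bigcap_measurable => // i _; exact: mZA.
    rewrite -[in RHS](setIT (\bigcap_(_ in _) _)) -integral_indic//.
    apply: eq_integral => w _; congr EFin.
    under eq_bigr do rewrite hE indicE.
    rewrite indicE -natr_prod; congr (_%:R).
    have [wA|wA] := pselect ((\bigcap_(i in [set` [set: 'I_n]%SET]) Z i @^-1` A i) w).
      rewrite mem_set// big1// => i _; rewrite mem_set//.
      by apply: wA; rewrite /= finset.in_setT.
    rewrite memNset//.
    have [i iA] : exists i, ~ A i (Z i w).
      by apply/existsNP => wA'; apply: wA => i _; exact: wA'.
    by rewrite (bigD1 i)//= memNset.
  rewrite indepZ//; apply: eq_big => [i|i _]; first by rewrite finset.in_setT.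
  by rewrite hE -[LHS]/(P _) -[in LHS](setIT (Z i @^-1` A i)) -integral_indic.
pose i0 : 'I_n := Ordinal kn.
pose H w := \prod_(i < n | i != i0) h i (Z i w).
pose c := (\prod_(i < n | i != i0) \int[P]_w (h i (Z i w))%:E)%E.
rewrite (bigD1 i0)//= -/c muleC.
under eq_integral do rewrite (bigD1 i0)//= -/(H _).
have c0 : (0 <= c)%E.
  by apply: prode_ge0 => i _; apply: integral_ge0 => w _; rewrite lee_fin.
apply: (integral_layer_cake (mu2 := P) (Z2 := Z i0)) => //.
- rewrite /H; under eq_fun do rewrite -big_filter.
  by apply: measurable_prod => i _; exact: measurableT_comp.
- by move=> w; apply: prodr_ge0.
move=> A mA; pose h' i := if i == i0 then \1_A else h i.
have h'0 : h' i0 = \1_A by rewrite /h' eqxx.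
have h'E i : i != i0 -> h' i = h i by rewrite /h' => /negbTE ->.
have := IH (ltnW kn) h'; rewrite [X in _ -> _ -> _ -> _ = X](bigD1 i0)//= h'0 => IH'.
under eq_integral => w _.
  rewrite (_ : \1_A (Z i0 w) * H w = \prod_(i < n) h' i (Z i w)); last first.
    rewrite (bigD1 i0)//= h'0; congr (_ * _).
    by apply: eq_bigr => i ii0; rewrite h'E.
  over.
rewrite IH'.
- rewrite muleC; congr (_ * _)%E.
  by apply: eq_bigr => i ii0; rewrite h'E.
- by move=> i; rewrite /h'; case: eqP => // _; exact: mI.
- by move=> i z; rewrite /h'; case: eqP.
- move=> i ki; rewrite /h'; case: eqP => [_|/eqP ii0]; first by exists A.
  by apply: hI; rewrite ltn_neqAle ki andbT; apply: contra ii0 => /eqP ki0; apply/eqP/val_inj.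
Qed.

(** * The law of a shifted tuple of independent variables *)

Definition rectangles {d} (T : measurableType d) (n : nat) : set (set (n.-tuple T)) :=
  [set A | exists2 B : 'I_n -> set T, (forall i, measurable (B i)) &
                                      A = [set z | forall i, B i (tnth z i)]].
Arguments rectangles {d} T n.

Lemma rectangles_setI_closed {d} (T : measurableType d) (n : nat) :
  setI_closed (rectangles T n).
Proof.
move=> _ _ [B mB ->] [C mC ->]; exists (fun i => B i `&` C i).
  by move=> i; exact: measurableI.
apply/seteqP; split => z /=; first by move=> [Bz Cz] i; split.
by move=> BCz; split => i; case: (BCz i).
Qed.

Lemma measurable_tuple_rectangles {d} (T : measurableType d) (n : nat) :
  @measurable _ (n.-tuple T) = <<s rectangles T n >>.
Proof.
rewrite eqEsubset; split.
  apply: smallest_sub; first exact: smallest_sigma_algebra.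
  rewrite -bigcup_seq => A [i _ [C mC <-]]; apply: sub_sigma_algebra.
  exists (fun j => if j == i then C else setT); first by move=> j; case: ifP.
  rewrite setTI; apply/seteqP; split => z /=.
    by move=> Cz j; case: eqP => // ->.
  by move=> /(_ i); rewrite eqxx.
apply: smallest_sub; first exact: sigma_algebra_measurable.
move=> _ [B mB ->].
have -> : [set z : n.-tuple T | forall i, B i (tnth z i)] =
    \bigcap_(i in [set: 'I_n]) ((fun z : n.-tuple T => tnth z i) @^-1` B i).
  by apply/seteqP; split => z /= Bz i; [move=> _; exact: Bz|exact: (Bz i)].
apply: fin_bigcap_measurable => // i _.
by rewrite -[X in measurable X]setTI; exact: measurable_tnth.
Qed.

(** If moving each [Z i] by [phi] amounts to weighting by [l], then moving all
    of them amounts to weighting by the product.  On rectangles this is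
    independence; both sides are finite measures of [A] and rectangles form a
    generating pi-system. *)
Lemma tuple_law_density {d d'} {Omega : measurableType d}
    {T : measurableType d'} {R : realType} (P : probability Omega R) (n : nat)
    (Z : 'I_n -> Omega -> T) (phi : T -> T) (l : T -> R) :
  (forall i, measurable_fun setT (Z i)) -> mutually_independent P Z ->
  measurable_fun setT phi -> measurable_fun setT l -> (forall z, 0 <= l z) ->
  (forall i A, measurable A ->
    P (Z i @^-1` (phi @^-1` A)) = \int[P]_(w in Z i @^-1` A) (l (Z i w))%:E)%E ->
  forall A : set (n.-tuple T), measurable A ->
  P [set w | A [tuple phi (Z i w) | i < n]] =
  (\int[P]_(w in [set w | A [tuple Z i w | i < n]])
     (\prod_(i < n) l (Z i w))%:E)%E.
Proof.
move=> mZ indepZ mphi ml l0 dens.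
pose W1 w : n.-tuple T := [tuple phi (Z i w) | i < n].
pose W0 w : n.-tuple T := [tuple Z i w | i < n].
pose L w := \prod_(i < n) l (Z i w).
have mL : measurable_fun setT (EFin \o L).
  apply/measurable_EFinP; apply: measurable_prod => i _.
  exact: measurableT_comp.
have L0 w : (0 <= (L w)%:E)%E by rewrite lee_fin prodr_ge0.
have mW1 : measurable_fun setT W1.
  apply/measurable_fun_tnthP => i; rewrite /W1.
  apply: (eq_measurable_fun (phi \o Z i)); last exact: measurableT_comp.
  by move=> w _ /=; rewrite tnth_mktuple.
have mW0 : measurable_fun setT W0.
  apply/measurable_fun_tnthP => i; rewrite /W0.
  apply: (eq_measurable_fun (Z i)) => //.
  by move=> w _ /=; rewrite tnth_mktuple.
have mpre (W : Omega -> n.-tuple T) A : measurable_fun setT W -> measurable A ->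
    measurable (W @^-1` A).
  by move=> mW mA; rewrite -[X in measurable X]setTI; exact: mW.
have rectP (A : set (n.-tuple T)) : rectangles T n A ->
    P (W1 @^-1` A) = (\int[P]_(w in W0 @^-1` A) (L w)%:E)%E.
  move=> [B mB ->].
  have mphiB i : measurable (phi @^-1` B i).
    by rewrite -[X in measurable X]setTI; exact: mphi.
  transitivity (\prod_(i < n) P (Z i @^-1` (phi @^-1` B i)))%E.
    transitivity (P (\bigcap_(i in [set` [set: 'I_n]%SET]) Z i @^-1` (phi @^-1` B i))).
      congr (P _); apply/seteqP; split => w /= Bw i.
        by move=> _; have := Bw i; rewrite /= tnth_mktuple.
      by rewrite tnth_mktuple; apply: Bw; rewrite /= finset.in_setT.
    by rewrite indepZ//; apply: eq_big => // i; rewrite finset.in_setT.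
  pose h i z := \1_(B i) z * l z.
  have mh i : measurable_fun setT (h i).
    by apply: measurable_funM => //; exact: measurable_indic.
  have h0 i z : 0 <= h i z by rewrite mulr_ge0.
  have prodE := expectation_prod_indep mZ indepZ mh h0.
  under eq_bigr => i _.
    rewrite dens// integral_mkcond.
    rewrite (_ : (\int[P]_x _)%E = (\int[P]_w (h i (Z i w))%:E)%E); last first.
      apply: eq_integral => w _; rewrite /h patchE indicE.
      by rewrite (_ : (w \in _) = (Z i w \in B i))//; case: ifP; rewrite ?mul1r ?mul0r.
    over.
  apply: (eq_trans (esym prodE)).
  rewrite [RHS]integral_mkcond; apply: eq_integral => w _; rewrite /h patchE big_split /= -/(L w).
  under eq_bigr do rewrite indicE.
  rewrite -natr_prod.
  have [wB|wB] := pselect (forall i, B i (Z i w)).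
    rewrite big1 ?mul1r; last by move=> i _; rewrite mem_set.
    by rewrite mem_set//= => i; rewrite tnth_mktuple.
  have [i iB] : exists i, ~ B i (Z i w) by apply/existsNP.
  rewrite (bigD1 i)//= memNset// mul0r memNset//= => wB'; apply: iB.
  by have := wB' i; rewrite tnth_mktuple.
move=> A mA; change (P (W1 @^-1` A) = (\int[P]_(w in W0 @^-1` A) (L w)%:E)%E).
have PT : P (W1 @^-1` setT) = (\int[P]_(w in W0 @^-1` setT) (L w)%:E)%E.
  apply: rectP; exists (fun=> setT) => //.
  by apply/seteqP; split.
apply: (dynkin_induction (P := fun A => P (W1 @^-1` A) =
    (\int[P]_(w in W0 @^-1` A) (L w)%:E)%E) (measurable_tuple_rectangles T n)) => //.
- exact: rectangles_setI_closed.
- move=> S mS PS.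
  have mS0 := mpre _ _ mW0 mS; have mS1 := mpre _ _ mW1 mS.
  have total : (1 = \int[P]_(w in W0 @^-1` S) (L w)%:E +
                    \int[P]_(w in ~` (W0 @^-1` S)) (L w)%:E)%E.
    rewrite -ge0_integral_setU//; last 3 first.
    + exact: measurableC.
    + exact: measurable_funS mL.
    + by rewrite disj_set2E setICr.
    rewrite setUCr; move: PT; rewrite !preimage_setT => <-.
    exact/esym/probability_setT.
  have -> : P (W1 @^-1` (~` S)) = (1 - P (W1 @^-1` S))%E.
    by rewrite preimage_setC probability_setC.
  have fS : P (W1 @^-1` S) \is a fin_num by exact: fin_num_measure.
  rewrite -[W0 @^-1` (~` S)]/(~` (W0 @^-1` S)); move: fS; rewrite PS => fS.
  by rewrite total addeAC subee// add0e.
- move=> F mF tF PF.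
  rewrite [W0 @^-1` _]preimage_bigcup ge0_integral_bigcup//; last 3 first.
  + by move=> k; exact: mpre.
  + exact: measurable_funS mL.
  + by move=> i j _ _ [w [/= Fi Fj]]; apply: (tF i j) => //; exists (W0 w).
  rewrite preimage_bigcup measure_semi_bigcup//; last 3 first.
  + by move=> k; exact: mpre.
  + by move=> i j _ _ [w [/= Fi Fj]]; apply: (tF i j) => //; exists (W1 w).
  + by apply: bigcup_measurable => k _; exact: mpre.
  by apply: eq_eseriesr => i _; exact: PF.
- by rewrite -measurable_tuple_rectangles.
Qed.

(** * Gaussian shifts *)

Lemma ge0_integral_lebesgue_shift {R : realType} (a : R) (f : R -> \bar R) :
  measurable_fun setT f -> (forall x, 0 <= f x)%E ->
  (\int[lebesgue_measure]_x f (x + a)%R = \int[lebesgue_measure]_x f x)%E.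
Proof.
move=> mf f0.
pose sh : measurableTypeR R -> measurableTypeR R := fun x => x + a.
have msh : measurable_fun setT sh by exact: measurable_funD.
transitivity (\int[pushforward lebesgue_measure sh]_x f x)%E.
  by rewrite ge0_integral_pushforward.
apply: eq_measure_integral => A mA _.
apply/esym/lebesgue_measure_unique => //= _ [[b c]] _ <-.
rewrite /pushforward (_ : sh @^-1` _ = `]b - a, c - a]%classic); last first.
  apply/seteqP; split => x /=; rewrite /sh !in_itv /=;
    by rewrite ltrBlDr lerBrDr.
by rewrite !lebesgue_measure_itv/= !lte_fin ltrD2r; case: ifP => // _;
  rewrite -!EFinB; congr EFin; ring.
Qed.

Lemma integral_normal_density {R : realType} (s : R) (h : R -> R) :
  measurable_fun setT h -> (forall x, 0 <= h x) ->
  (\int[normal_prob 0 s]_x (h x)%:E =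
   \int[lebesgue_measure]_x (h x * normal_pdf 0 s x)%:E)%E.
Proof.
move=> mh h0; rewrite -[LHS]mul1e; apply/esym.
apply: (integral_layer_cake (Z1 := id) (Z2 := id)) => //.
- exact: measurable_normal_pdf.
- by move=> x; exact: normal_pdf_ge0.
move=> A mA; rewrite mul1e integral_indic// setIT /normal_prob [RHS]integral_mkcond.
apply: eq_integral => x _; rewrite patchE indicE; case: ifP => _.
  by rewrite mul1r.
by rewrite mul0r.
Qed.

(** Likelihood ratio at [e] of the normal law with mean [a] to the centred one,
    both with standard deviation [s]. *)
Definition normal_lr {R : realType} (s a e : R) : R :=
  expR ((2 * e * a - a ^+ 2) / (2 * s ^+ 2)).

Lemma normal_prob_shift {R : realType} (s a : R) (A : set R) :
  s != 0 -> measurable A ->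
  (\int[normal_prob 0 s]_e ((\1_A (e + a) : R))%:E =
   \int[normal_prob 0 s]_e ((\1_A e : R) * normal_lr s a e)%:E)%E.
Proof.
move=> s0 mA.
have mI : measurable_fun setT (\1_A : R -> R) by exact: measurable_indic.
have mlr : measurable_fun setT (normal_lr s a).
  apply: measurableT_comp => //; apply: measurable_funM => //.
  by apply: measurable_funB => //; apply: measurable_funM => //; apply: measurable_funM.
rewrite !integral_normal_density//; last 3 first.
- exact: measurable_funM.
- by move=> x; rewrite mulr_ge0// expR_ge0.
- by apply: (measurableT_comp mI); exact: measurable_funD.
pose f (x : R) : \bar R := ((\1_A x : R) * normal_pdf 0 s (x - a))%:E.
rewrite -[RHS](_ : \int[lebesgue_measure]_x f x = _)%E; last first.
  apply: eq_integral => x _; rewrite /f -mulrA; congr (_ * _)%:E.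
  rewrite !normal_pdfE// mulrCA; congr (_ * _).
  rewrite /normal_fun /normal_lr -expRD; congr expR.
  by field.
rewrite -[RHS](@ge0_integral_lebesgue_shift R a f).
- by apply: eq_integral => x _; rewrite /f addrK.
- apply/measurable_EFinP; apply: measurable_funM => //.
  by apply: (measurableT_comp (measurable_normal_pdf 0 s)); exact: measurable_funB.
- by move=> x; rewrite lee_fin mulr_ge0// normal_pdf_ge0.
Qed.

(** One observation: [X] and [eps] have a product law, so the claim reduces by
    Fubini to a translation of the normal law by [g x] for each fixed [x]. *)
Lemma regression_shift_density {d d'} {Omega : measurableType d}
    {T : measurableType d'} {R : realType} (P : probability Omega R)
    (PX : probability T R) (s : R) (X : {RV P >-> T}) (eps : {RV P >-> R})
    (g : T -> R) :
  s != 0 ->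
  (forall A, measurable A -> distribution P X A = PX A) ->
  (forall B, measurable B -> distribution P eps B = normal_prob 0 s B) ->
  independent_rvs P X eps -> measurable_fun setT g ->
  forall A : set (T * R), measurable A ->
  P [set w | A (X w, eps w + g (X w))] =
  (\int[P]_(w in [set w | A (X w, eps w)])
     (normal_lr s (g (X w)) (eps w))%:E)%E.
Proof.
move=> s0 lawX laweps indep mg A mA.
pose Z w := (X w, eps w).
have mZ : measurable_fun setT Z by exact: measurable_fun_pair.
pose N := distribution P eps.
have intN (h : R -> R) : measurable_fun setT h -> (forall x, 0 <= h x) ->
    (\int[N]_x (h x)%:E = \int[normal_prob 0 s]_x (h x)%:E)%E.
  move=> mh h0.
  rewrite -[RHS]mul1e; under eq_integral do rewrite -[h _]mulr1.
  apply: (@integral_layer_cake _ _ _ _ _ _ _ N (normal_prob 0 s) id id (fun=> 1)) => //.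
  move=> B mB; rewrite mul1e; under eq_integral do rewrite mulr1.
  by rewrite !integral_indic// !setIT; exact: laweps.
have lawZ (B : set (T * R)) : measurable B -> P (Z @^-1` B) = (PX \x N)%E B.
  move=> mB; apply/esym.
  apply: (@product_measure_unique _ _ _ _ _ PX N (pushforward P Z)) => //.
  move=> B1 B2 mB1 mB2; apply: (eq_trans (indep _ _ mB1 mB2)).
  by congr (_ * _)%E; exact: lawX.
have mpreZ B : measurable B -> measurable (Z @^-1` B).
  by move=> mB; rewrite -[X in measurable X]setTI; exact: mZ.
have intZ (h : T * R -> R) : measurable_fun setT h -> (forall z, 0 <= h z) ->
    (\int[P]_w (h (Z w))%:E = \int[(PX \x N)%E]_z (h z)%:E)%E.
  move=> mh h0.
  transitivity (\int[pushforward P Z]_z (h z)%:E)%E.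
    rewrite (ge0_integral_pushforward mZ) ?preimage_setT//.
      exact/measurable_EFinP.
    by move=> z _; rewrite lee_fin.
  by apply: eq_measure_integral => B mB _; exact: lawZ.
pose sh (z : T * R) := (z.1, z.2 + g z.1).
have msh : measurable_fun setT sh.
  apply: measurable_fun_pair => //; apply: measurable_funD => //.
  exact: measurableT_comp.
have mI : measurable_fun setT (\1_A : T * R -> R) by exact: measurable_indic.
have mlr : measurable_fun setT (fun z : T * R => normal_lr s (g z.1) z.2).
  apply: measurableT_comp => //; apply: measurable_funM => //.
  have mg1 : measurable_fun setT (fun z : T * R => g z.1) by exact: measurableT_comp.
  apply: measurable_funB => //; last exact: measurable_funX.
  by apply: measurable_funM => //; exact: measurable_funM.
rewrite integral_mkcond.
transitivity (\int[P]_w ((\1_A (Z w) : R) * normal_lr s (g (Z w).1) (Z w).2)%:E)%E;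
  last first.
  apply: eq_integral => w _; rewrite patchE indicE.
  by rewrite (_ : (w \in _) = (Z w \in A))//; case: ifP; rewrite ?mul1r ?mul0r.
rewrite (intZ (fun z => (\1_A z : R) * normal_lr s (g z.1) z.2)); last 2 first.
- exact: measurable_funM.
- by move=> z; rewrite mulr_ge0// expR_ge0.
transitivity (\int[P]_w ((\1_A (sh (Z w)) : R))%:E)%E.
  have mshZ : measurable ((sh \o Z) @^-1` A).
    by apply: (mpreZ (sh @^-1` A)); rewrite -[X in measurable X]setTI; exact: msh.
  rewrite -[LHS]/(P ((sh \o Z) @^-1` A)).
  by rewrite -[in LHS](setIT (_ @^-1` A)) -integral_indic.
have mIsh : measurable_fun setT (fun z => \1_A (sh z) : R).
  exact: measurableT_comp.
rewrite (intZ (fun z => \1_A (sh z) : R))//.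
have mE (h : T * R -> R) : measurable_fun setT h ->
    measurable_fun setT (fun z => (h z)%:E) by move=> ?; exact/measurable_EFinP.
rewrite (fubini_tonelli1 (fun z => (\1_A (sh z) : R)%:E))//; last exact: mE.
rewrite (fubini_tonelli1 (fun z => ((\1_A z : R) * normal_lr s (g z.1) z.2)%:E))//;
  last 2 first.
- by apply: mE; exact: measurable_funM.
- by move=> z; rewrite lee_fin mulr_ge0// expR_ge0.
apply: eq_integral => x _; rewrite /fubini_F /sh /=.
have mx : measurable (xsection A x) by exact: measurable_xsection.
have mIx : measurable_fun setT (\1_(xsection A x) : R -> R).
  exact: measurable_indic.
have xE e : (\1_A (x, e) : R) = \1_(xsection A x) e.
  by rewrite !indicE mem_xsection.
under eq_integral do rewrite xE; under [RHS]eq_integral do rewrite xE.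
rewrite !intN//.
- exact: normal_prob_shift.
- apply: measurable_funM => //; apply: measurableT_comp => //.
  apply: measurable_funM => //; apply: measurable_funB => //.
  by apply: measurable_funM => //; exact: measurable_funM.
- by move=> e; rewrite mulr_ge0// expR_ge0.
- by apply: (measurableT_comp mIx); exact: measurable_funD.
Qed.

(** * Change of measure for the regression sample *)

Section regression.
Context {d} {Omega : measurableType d} {R : realType} (P : probability Omega R).
Context {n M : nat} (PX : probability (M.-tuple R) R) (sigma : R).
Variables (X : 'I_n -> {RV P >-> M.-tuple R}) (eps : 'I_n -> {RV P >-> R}).
Hypothesis design : regression_design PX sigma X eps.
Hypothesis sigma0 : 0 < sigma.

Local Notation noise w := [tuple (X i w, eps i w) | i < n].

Let pair_measurable i : measurable_fun setT (fun w => (X i w, eps i w)).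
Proof. exact: measurable_fun_pair. Qed.

Lemma measurable_sample (f0 : M.-tuple R -> R) : measurable_fun setT f0 ->
  measurable_fun setT (sample X eps f0).
Proof.
move=> mf0; apply/measurable_fun_tnthP => i.
apply: (eq_measurable_fun (fun w => (X i w, f0 (X i w) + eps i w))).
  by move=> w _ /=; rewrite tnth_mktuple.
apply: measurable_fun_pair => //; apply: measurable_funD => //.
exact: measurableT_comp.
Qed.

Lemma sample_shift_density (g : M.-tuple R -> R)
    (A : set (n.-tuple (M.-tuple R * R))) :
  measurable_fun setT g -> measurable A ->
  P [set w | A [tuple (X i w, eps i w + g (X i w)) | i < n]] =
  (\int[P]_(w in [set w | A (noise w)])
     (\prod_(i < n) normal_lr sigma (g (X i w)) (eps i w))%:E)%E.
Proof.
move=> mg mA.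
pose phi (z : M.-tuple R * R) := (z.1, z.2 + g z.1).
pose l (z : M.-tuple R * R) := normal_lr sigma (g z.1) z.2.
have mphi : measurable_fun setT phi.
  apply: measurable_fun_pair => //; apply: measurable_funD => //.
  exact: measurableT_comp.
have ml : measurable_fun setT l.
  apply: measurableT_comp => //; apply: measurable_funM => //.
  have mg1 : measurable_fun setT (fun z : M.-tuple R * R => g z.1).
    exact: measurableT_comp.
  apply: measurable_funB => //; last exact: measurable_funX.
  by apply: measurable_funM => //; exact: measurable_funM.
apply: (tuple_law_density pair_measurable (design_indep_pairs design) mphi ml) => //.
  by move=> z; exact: expR_ge0.
move=> i B mB; apply: regression_shift_density => //; first by rewrite gt_eqF.
- exact: (design_law_eps design i).
- exact: (design_indep_eps design i).
Qed.

(** Two-point comparison.  Let [L] be the likelihood ratio of the sample with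
    regression function [f0 + g] to the one with [f0].  On the event that
    [\sum_i g (X i) ^ 2 <= r * sigma ^ 2] use
    [L <= c / 2 + L ^ 2 / (2 * c)].  The square of [L] is the likelihood ratio
    for the shift [2 * g], which integrates to 1, times
    [exp (\sum_i g (X i) ^ 2 / sigma ^ 2)], which is at most [exp r] there.
    Averaged over [B] competing events [A], the choice [c = sqrt B] makes
    both of order at most [B ^ (-1/4)] as long as [exp r <= B ^ (1/4)]. *)
Lemma sample_shift_prob_le (f0 g : M.-tuple R -> R) (r c : R)
    (A : set (n.-tuple (M.-tuple R * R))) :
  measurable_fun setT f0 -> measurable_fun setT g -> measurable A -> 0 < c ->
  (P [set w | A (sample X eps (f0 \+ g)%R w)] <=
   P [set w | (r * sigma ^+ 2 < \sum_(i < n) g (X i w) ^+ 2)%R] +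
   (c / 2)%:E * P [set w | A (sample X eps f0 w)] + (expR r / (2 * c))%:E)%E.
Proof.
move=> mf0 mg mA c0.
have s2 : 0 < sigma ^+ 2 by rewrite exprn_gt0.
pose add (u : n.-tuple (M.-tuple R * R)) : n.-tuple (M.-tuple R * R) :=
  [tuple ((tnth u i).1, f0 (tnth u i).1 + (tnth u i).2) | i < n].
pose S (u : n.-tuple (M.-tuple R * R)) := \sum_(i < n) g (tnth u i).1 ^+ 2.
have mtn i : measurable_fun setT (fun u : n.-tuple (M.-tuple R * R) => tnth u i).
  exact: measurable_tnth.
have mtn1 i : measurable_fun setT (fun u : n.-tuple (M.-tuple R * R) => (tnth u i).1).
  exact: measurableT_comp.
have madd : measurable_fun setT add.
  apply/measurable_fun_tnthP => i.
  apply: (eq_measurable_fun (fun u : n.-tuple (M.-tuple R * R) =>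
      ((tnth u i).1, f0 (tnth u i).1 + (tnth u i).2))).
    by move=> w _ /=; rewrite tnth_mktuple.
  apply: measurable_fun_pair => //; apply: measurable_funD => //.
    exact: measurableT_comp.
  exact: measurableT_comp.
have mS : measurable_fun setT S.
  apply: measurable_sum => i; apply: measurable_funX; exact: measurableT_comp.
pose A' := add @^-1` A.
have mA' : measurable A' by rewrite -[X in measurable X]setTI; exact: madd.
pose D := [set u | S u <= r * sigma ^+ 2].
have mD : measurable D.
  rewrite -[X in measurable X]setTI (_ : D = S @^-1` `]-oo, r * sigma ^+ 2]); first exact: mS.
  by apply/seteqP; split => u /=; rewrite in_itv.
have mnoise : measurable_fun setT (fun w => noise w).
  apply/measurable_fun_tnthP => i.
  apply: (eq_measurable_fun (fun w => (X i w, eps i w))) => //.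
  by move=> w _ /=; rewrite tnth_mktuple.
have mpre B : measurable B -> measurable [set w | B (noise w)].
  by move=> mB; rewrite -[X in measurable X]setTI; exact: mnoise.
pose W w := [tuple (X i w, eps i w + g (X i w)) | i < n].
have mW : measurable_fun setT W.
  apply/measurable_fun_tnthP => i.
  apply: (eq_measurable_fun (fun w => (X i w, eps i w + g (X i w)))).
    by move=> w _ /=; rewrite tnth_mktuple.
  apply: measurable_fun_pair => //; apply: measurable_funD => //.
  exact: measurableT_comp.
have mpreW B : measurable B -> measurable [set w | B (W w)].
  by move=> mB; rewrite -[X in measurable X]setTI; exact: mW.
have SW w : S (W w) = \sum_(i < n) g (X i w) ^+ 2.
  by apply: eq_bigr => i _; rewrite tnth_mktuple.
have SN w : S (noise w) = \sum_(i < n) g (X i w) ^+ 2.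
  by apply: eq_bigr => i _; rewrite tnth_mktuple.
have addW w : add (W w) = sample X eps (f0 \+ g)%R w.
  by apply: eq_from_tnth => i; rewrite !tnth_mktuple /= addrAC addrA.
have addN w : add (noise w) = sample X eps f0 w.
  by apply: eq_from_tnth => i; rewrite !tnth_mktuple.
have -> : [set w | A (sample X eps (f0 \+ g)%R w)] = [set w | A' (W w)].
  by apply/seteqP; split => w; rewrite /A' /= addW.
have -> : [set w | A (sample X eps f0 w)] = [set w | A' (noise w)].
  by apply/seteqP; split => w; rewrite /A' /= addN.
have -> : [set w | r * sigma ^+ 2 < \sum_(i < n) g (X i w) ^+ 2] =
    [set w | (~` D) (W w)].
  apply/seteqP; split => w; rewrite /D /= SW; first by rewrite ltNge => /negP.
  by move=> /negP; rewrite -ltNge.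
have mAD : measurable (A' `&` D) by exact: measurableI.
apply: (@le_trans _ _ (P ([set w | (~` D) (W w)] `|` [set w | (A' `&` D) (W w)]))).
  apply: le_measure; rewrite ?inE; first exact: mpreW.
    by apply: measurableU; apply: mpreW => //; exact: measurableC.
  move=> w /= Aw; have [Dw|Dw] := pselect (D (W w)); [right|left] => //.
have mDW : measurable [set w | (~` D) (W w)].
  by apply: mpreW; exact: measurableC.
apply: (le_trans (measureU2 _ mDW (mpreW _ mAD))).
rewrite -addeA; apply: leeD => //.
apply: le_trans.
  rewrite le_eqVlt; apply/orP; left; apply/eqP.
  exact: (sample_shift_density mg mAD).
pose L (k : R) w := \prod_(i < n) normal_lr sigma (k * g (X i w)) (eps i w).
have mL k : measurable_fun setT (L k).
  apply: measurable_prod => i _; apply: measurableT_comp => //.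
  apply: measurable_funM => //.
  have mg1 : measurable_fun setT (fun w => k * g (X i w)).
    by apply: measurable_funM => //; exact: measurableT_comp.
  apply: measurable_funB => //; last exact: measurable_funX.
  by apply: measurable_funM => //; exact: measurable_funM.
have L0 k w : 0 <= L k w by apply: prodr_ge0 => i _; exact: expR_ge0.
have intL2 : (\int[P]_w (L 2 w)%:E = 1)%E.
  have m2g : measurable_fun setT (fun x => 2 * g x) by exact: measurable_funM.
  have := @sample_shift_density _ setT m2g measurableT.
  rewrite (_ : [set w | _] = setT); last by apply/seteqP; split.
  by rewrite probability_setT => <-.
pose B := [set w | (A' `&` D) (noise w)].
have mB : measurable B by exact: mpre.
have LE w : L 1 w ^+ 2 = L 2 w * expR (S (noise w) / sigma ^+ 2).
  rewrite /L -prodrXl SN mulr_suml expR_sum -big_split /=; apply: eq_bigr => i _.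
  rewrite /normal_lr -expRM_natl -expRD; congr expR.
  by field; rewrite gt_eqF.
have bound w : B w -> L 1 w <= c / 2 + expR r / (2 * c) * L 2 w.
  move=> [_ Dw].
  have LD : L 1 w ^+ 2 <= L 2 w * expR r.
    by rewrite LE ler_wpM2l// ler_expR ler_pdivrMr.
  rewrite -subr_ge0.
  have -> : c / 2 + expR r / (2 * c) * L 2 w - L 1 w =
     ((L 1 w - c) ^+ 2 + (L 2 w * expR r - L 1 w ^+ 2)) / (2 * c).
    by field; rewrite gt_eqF.
  apply: divr_ge0; last by rewrite mulr_ge0// ltW.
  by apply: addr_ge0; [exact: sqr_ge0|rewrite subr_ge0].
have mLE k : measurable_fun setT (fun w => (L k w)%:E) by exact/measurable_EFinP.
have cr0 : 0 <= expR r / (2 * c) by rewrite divr_ge0 ?expR_ge0 ?mulr_ge0 ?ltW.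
apply: (@le_trans _ _ (\int[P]_(w in B) (L 1 w)%:E)%E).
  rewrite le_eqVlt; apply/orP; left; apply/eqP; apply: eq_integral => w _.
  by congr EFin; apply: eq_bigr => i _; rewrite mul1r.
apply: (@le_trans _ _ (\int[P]_(w in B) ((c / 2)%:E + (expR r / (2 * c))%:E * (L 2 w)%:E))%E).
  apply: ge0_le_integral => //.
  - by move=> w _; rewrite lee_fin.
  - exact: measurable_funS (mLE 1).
  - apply: measurable_funTS; apply: emeasurable_funD => //.
    exact: emeasurable_funM.
rewrite ge0_integralD//; last 3 first.
- by move=> w _; rewrite lee_fin divr_ge0// ltW.
- by move=> w _; rewrite mule_ge0// lee_fin.
- apply: measurable_funTS; exact: emeasurable_funM.
apply: leeD.
  rewrite integral_cst//; apply: lee_pmul => //; first by rewrite lee_fin divr_ge0// ltW.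
  apply: le_measure; rewrite ?inE//; first exact: mpre.
  by move=> w [].
rewrite ge0_integralZl//; last 2 first.
- exact: measurable_funTS.
- by move=> w _; rewrite lee_fin.
rewrite -[leRHS]mule1; apply: lee_pmul => //.
  by apply: integral_ge0 => w _; rewrite lee_fin.
by rewrite -intL2; apply: ge0_subset_integral => // w _; rewrite lee_fin.
Qed.

End regression.

(** * Squared norms, tail bound and measurable minimisation *)

Lemma L2norm_sqr {R : realType} {M : nat} (PX : probability (M.-tuple R) R)
    (f : M.-tuple R -> R) :
  (L2norm PX f ^+ 2 = \int[PX]_x (f x ^+ 2)%:E)%E.
Proof.
have poweR2 (x : \bar R) : (0 <= x -> x `^ 2%R = x ^+ 2)%E.
  case: x => [r|_|//]; last by rewrite poweRyr// expe2 mulyy.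
  by rewrite lee_fin => r0; rewrite poweR_EFin powR_mulrn// EFin_expe.
rewrite -poweR2 ?Lnorm_ge0// /L2norm poweR_Lnorm//.
apply: eq_integral => x _.
by rewrite poweR2// -EFin_expe; congr EFin; rewrite -normrX ger0_norm// sqr_ge0.
Qed.

Lemma measurable_linear_fun {R : realType} {M : nat} (theta : 'rV[R]_M) :
  measurable_fun setT (linear_fun theta).
Proof.
apply: measurable_sum => j; apply: measurable_funM => //.
exact: measurable_tnth.
Qed.

Section SRC_squared.
Context {R : realType} {M : nat} (PX : probability (M.-tuple R) R).
Variables (alo ahi : R) (k : nat).
Hypotheses (alo0 : 0 < alo) (src : SRC PX alo ahi k).
Variable theta : 'rV[R]_M.
Hypothesis sparse : (l0norm theta <= minn (2 * k) M)%N.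

Let l2norm_sqr : l2norm theta ^+ 2 = \sum_(j < M) theta ord0 j ^+ 2.
Proof. by rewrite sqr_sqrtr// sumr_ge0// => j _; rewrite sqr_ge0. Qed.

Let sqr_le (x y : \bar R) : (0 <= x -> x <= y -> x ^+ 2 <= y ^+ 2)%E.
Proof. by move=> x0 xy; rewrite !expe2; apply: lee_pmul. Qed.

Lemma SRC_sqr_ge :
  ((alo ^+ 2 * \sum_(j < M) theta ord0 j ^+ 2)%:E
     <= \int[PX]_x (linear_fun theta x ^+ 2)%:E)%E.
Proof.
rewrite -L2norm_sqr -l2norm_sqr -exprMn EFin_expe; apply: sqr_le.
  by rewrite lee_fin; apply: mulr_ge0; [exact: ltW|exact: sqrtr_ge0].
by have [] := src sparse.
Qed.

Lemma SRC_sqr_le :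
  (\int[PX]_x (linear_fun theta x ^+ 2)%:E
     <= (ahi ^+ 2 * \sum_(j < M) theta ord0 j ^+ 2)%:E)%E.
Proof.
rewrite -L2norm_sqr -l2norm_sqr -exprMn EFin_expe; apply: sqr_le.
  exact: Lnorm_ge0.
by have [] := src sparse.
Qed.

End SRC_squared.

(** Markov's inequality; only the second moment of [g] under the design law is
    available. *)
Lemma design_sum_markov {d} {Omega : measurableType d} {R : realType}
    (P : probability Omega R) {n M : nat} (PX : probability (M.-tuple R) R)
    (sigma : R) (X : 'I_n -> {RV P >-> M.-tuple R}) (eps : 'I_n -> {RV P >-> R})
    (g : M.-tuple R -> R) (V t : R) :
  regression_design PX sigma X eps -> measurable_fun setT g -> 0 < t ->
  (\int[PX]_x (g x ^+ 2)%:E <= V%:E)%E ->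
  (P [set w | (t < \sum_(i < n) g (X i w) ^+ 2)%R] <= (n%:R * V / t)%:E)%E.
Proof.
move=> design mg t0 gV.
pose S w := \sum_(i < n) g (X i w) ^+ 2.
have mgX i : measurable_fun setT (fun w => g (X i w) ^+ 2).
  by apply: measurable_funX; exact: measurableT_comp.
have mS : measurable_fun setT S by exact: measurable_sum.
pose B := [set w | t < S w].
have mB : measurable B.
  rewrite -[X in measurable X]setTI (_ : B = S @^-1` `]t, +oo[); first exact: mS.
  by apply/seteqP; split => u /=; rewrite in_itv /= andbT.
have intS : (\int[P]_w (S w)%:E <= (n%:R * V)%:E)%E.
  under eq_integral do rewrite -sumEFin.
  rewrite ge0_integral_sum//; last 2 first.
  - by move=> i; exact/measurable_EFinP.
  - by move=> i w _; rewrite lee_fin sqr_ge0.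
  apply: (@le_trans _ _ (\sum_(i < n) V%:E)%E).
    apply: lee_sum => i _; apply: le_trans gV.
    rewrite le_eqVlt; apply/orP; left; apply/eqP.
    have mg2 : measurable_fun setT (fun x => (g x ^+ 2)%:E).
      by apply/measurable_EFinP; exact: measurable_funX.
    rewrite -[LHS](ge0_integral_distribution (X i) mg2); last first.
      by move=> y; rewrite lee_fin sqr_ge0.
    by apply: eq_measure_integral => A mA _; exact: (design_lawX design i).
  by rewrite sumEFin lee_fin sumr_const card_ord mulr_natl.
rewrite mulrC EFinM lee_pdivlMl//.
apply: le_trans intS; rewrite -[P _]/(P B) -(setIT B) -integral_indic//.
rewrite -ge0_integralZl//; last 2 first.
- exact/measurable_EFinP/measurable_indic.
- by rewrite lee_fin ltW.
apply: ge0_le_integral => //.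
- by move=> w _; rewrite -EFinM lee_fin mulr_ge0// ltW.
- apply/measurable_EFinP; apply: measurable_funM => //; exact: measurable_indic.
- exact/measurable_EFinP.
- move=> w _; rewrite -EFinM lee_fin indicE; have [wB|wB] := pselect (B w).
    by rewrite mem_set// mulr1; exact: ltW.
  by rewrite memNset// mulr0 sumr_ge0// => i _; rewrite sqr_ge0.
Qed.

(** Ties are broken by the order of enumeration, which keeps the selection
    measurable; the induction carries the measurability of the running
    minimum. *)
Lemma measurable_argmin {d} {T : measurableType d} {R : realType}
    (I : finType) (i0 : I) (D : I -> T -> \bar R) :
  (forall i, measurable_fun setT (D i)) ->
  exists v : T -> I, (forall z i, (D (v z) z <= D i z)%E) /\
                     (forall i, measurable (v @^-1` [set i])).
Proof.
move=> mD.
suff [v [vmin _ mv]] : exists v : T -> I,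
    [/\ forall z i, i \in enum I -> (D (v z) z <= D i z)%E,
        measurable_fun setT (fun z => D (v z) z) &
        forall i, measurable (v @^-1` [set i])].
  by exists v; split => // z i; apply: vmin; rewrite mem_enum.
elim: (enum I) => [|j s [v [vmin mDv mv]]].
  exists (fun=> i0); split => //.
  move=> i; have [->|ne] := eqVneq i i0.
    by rewrite (_ : _ @^-1` _ = setT)//; apply/seteqP; split.
  rewrite (_ : _ @^-1` _ = set0)//; apply/seteqP; split => // z /= e.
  by rewrite e eqxx in ne.
pose C := [set z | (D j z <= D (v z) z)%E].
have mC : measurable C by rewrite -[C]setTI; exact: measurable_lee.
exists (fun z => if (D j z <= D (v z) z)%E then j else v z); split.
- move=> z i; rewrite inE => /orP[/eqP ->|/vmin le].
    by case: ifPn => // ; rewrite -ltNge => /ltW.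
  by case: ifPn => // le'; exact: le_trans le' (le z).
- apply: (eq_measurable_fun (fun z => mine (D j z) (D (v z) z))); last first.
    exact: measurable_mine.
  by move=> z _; rewrite minElt; case: ltgtP => // ->.
- move=> i.
  have -> : (fun z => if (D j z <= D (v z) z)%E then j else v z) @^-1` [set i] =
     (if i == j then C else set0) `|` ((~` C) `&` v @^-1` [set i]).
    apply/seteqP; split => z /=.
      rewrite /C /=; case: ifPn => [le <-|nle vi]; first by rewrite eqxx; left.
      by right; split => //; exact/negP.
    case=> [|[/negP/negbTE -> //]].
    by case: eqP => // -> zC; rewrite ifT.
  apply: measurableU; first by case: ifP.
  by apply: measurableI => //; exact: measurableC.
Qed.

(** * Block-sparse parameters *)

Section block_hypotheses.
Context {R : realType} {M K B : nat}.
Variables (idx : 'I_K * 'I_B -> 'I_M) (idx_inj : injective idx) (alpha : R).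
Implicit Types v u : {ffun 'I_K -> 'I_B}.

Definition block_sparse v : 'rV[R]_M :=
  \row_i \sum_(b < K) (if idx (b, v b) == i then alpha else 0).

Let sum_codom {V : nmodType} (F : 'I_M -> V) :
  (forall i, i \notin codom idx -> F i = 0) ->
  \sum_(i < M) F i = \sum_(b < K) \sum_(j < B) F (idx (b, j)).
Proof.
move=> F0; rewrite (bigID (mem (codom idx))) /= [X in _ + X]big1 // addr0.
rewrite -big_uniq /=; last by rewrite /codom /image_mem map_inj_uniq// enum_uniq.
by rewrite big_image /= pair_big /=; apply: eq_bigr => -[b j] _.
Qed.

Let block_sparse_idx v b j :
  block_sparse v ord0 (idx (b, j)) = if v b == j then alpha else 0.
Proof.
rewrite mxE (bigD1 b)//= big1 ?addr0 => [|b' b'b].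
  by rewrite (inj_eq idx_inj) xpair_eqE eqxx.
by rewrite (inj_eq idx_inj) xpair_eqE (negbTE b'b).
Qed.

Let block_sparse_out v i : i \notin codom idx -> block_sparse v ord0 i = 0.
Proof.
move=> iN; rewrite mxE big1// => b _; case: eqP => // bi.
by case/negP: iN; rewrite -bi codom_f.
Qed.

Lemma sum_block_sparse {V : nmodType} (phi : R -> V) v : phi 0 = 0 ->
  \sum_(i < M) phi (block_sparse v ord0 i) = phi alpha *+ K.
Proof.
move=> phi0; rewrite sum_codom => [|i iN]; last by rewrite block_sparse_out.
rewrite -[K in RHS]card_ord -sumr_const; apply: eq_bigr => b _.
rewrite (bigD1 (v b))//= block_sparse_idx eqxx big1 ?addr0// => j jv.
by rewrite block_sparse_idx eq_sym (negbTE jv).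
Qed.

Lemma l0norm_block_sparse v : (l0norm (block_sparse v) <= K)%N.
Proof.
rewrite /l0norm -sum1_card big_mkcond /=.
rewrite (sum_block_sparse (phi := fun x => nat_of_bool (x != 0))) ?eqxx//.
case: (alpha != 0); last by rewrite /= mul0rn.
by rewrite (_ : (true : nat) *+ K = K)//; exact: natn.
Qed.

(** A block in which [u] and [v] disagree contributes [alpha ^ 2] already through
    the entry of [u]. *)
Lemma block_sparse_dist_ge u v :
  alpha ^+ 2 * \sum_(b < K) (u b != v b)%:R <=
  \sum_(i < M) (block_sparse u - block_sparse v) ord0 i ^+ 2.
Proof.
have subE i : (block_sparse u - block_sparse v) ord0 i =
    block_sparse u ord0 i - block_sparse v ord0 i by rewrite mxE [X in _ + X]mxE.
under [leRHS]eq_bigr do rewrite subE.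
rewrite sum_codom => [|i iN]; last first.
  by rewrite !block_sparse_out// subrr expr0n.
rewrite mulr_sumr; apply: ler_sum => b _.
rewrite (bigD1 (u b))//= !block_sparse_idx eqxx.
rewrite [v b == u b]eq_sym; case: eqP => _ /=.
  by rewrite mulr0 subrr expr0n/= add0r sumr_ge0// => j _; exact: sqr_ge0.
by rewrite mulr1 subr0 lerDl sumr_ge0// => j _; exact: sqr_ge0.
Qed.

Lemma linear_fun_block_sparse v x :
  linear_fun (block_sparse v) x = \sum_(b < K) alpha * tnth x (idx (b, v b)).
Proof.
rewrite /linear_fun sum_codom => [|i iN]; last by rewrite block_sparse_out// mul0r.
apply: eq_bigr => b _; rewrite (bigD1 (v b))//= block_sparse_idx eqxx.
rewrite big1 ?addr0// => j jv.
by rewrite block_sparse_idx eq_sym (negbTE jv) mul0r.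
Qed.

End block_hypotheses.

Lemma l0norm_sub {R : realType} {M : nat} (u v : 'rV[R]_M) :
  (l0norm (u - v) <= l0norm u + l0norm v)%N.
Proof.
rewrite /l0norm -cardUI; apply: leq_trans (leq_addr _ _).
apply: subset_leq_card; apply/fintype.subsetP => j; rewrite !inE.
apply: contraR; rewrite negb_or !negbK => /andP[/eqP u0 /eqP v0].
by rewrite mxE [X in _ + X]mxE u0 v0 subrr.
Qed.

Lemma linear_fun_sub {R : realType} {M : nat} (u v : 'rV[R]_M) x :
  linear_fun (u - v) x = linear_fun u x - linear_fun v x.
Proof.
rewrite /linear_fun -sumrB; apply: eq_bigr => j _.
by rewrite mxE [X in _ + X]mxE mulrBl.
Qed.

Lemma l0norm_delta {R : realType} {M : nat} (a : R) (j : 'I_M) :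
  (l0norm (a *: delta_mx ord0 j : 'rV[R]_M) <= 1)%N.
Proof.
rewrite /l0norm -[leqRHS](card1 j); apply: subset_leq_card; apply/fintype.subsetP => i.
by rewrite !inE !mxE /=; apply: contraR => /negbTE ->; rewrite mulr0.
Qed.

Lemma sum_sqr_delta {R : realType} {M : nat} (a : R) (j : 'I_M) :
  \sum_(i < M) (a *: delta_mx ord0 j : 'rV[R]_M) ord0 i ^+ 2 = a ^+ 2.
Proof.
rewrite (bigD1 j)//= !mxE !eqxx mulr1 big1 ?addr0// => i ij.
by rewrite !mxE eqxx (negbTE ij) mulr0 expr0n.
Qed.

Lemma linear_fun_delta {R : realType} {M : nat} (a : R) (j : 'I_M) x :
  linear_fun (a *: delta_mx ord0 j) x = a * tnth x j.
Proof.
rewrite /linear_fun (bigD1 j)//= !mxE !eqxx mulr1 big1 ?addr0// => i ij.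
by rewrite !mxE eqxx (negbTE ij) mulr0 mul0r.
Qed.

(** * From estimation to testing *)

Section testing_reduction.
Context {d} {Omega : measurableType d} {R : realType} (P : probability Omega R).
Context {n M K B : nat} (PX : probability (M.-tuple R) R).
Variables (X : 'I_n -> {RV P >-> M.-tuple R}) (eps : 'I_n -> {RV P >-> R}).
Variables (alo ahi : R) (k : nat).
Hypotheses (alo0 : 0 < alo) (src : SRC PX alo ahi k).
Variables (idx : 'I_K * 'I_B -> 'I_M) (idx_inj : injective idx) (Kk : (K <= k)%N).
Variable alpha : R.

Local Notation hyp v := (linear_fun (block_sparse idx alpha v)).

Lemma hypotheses_separated (u v : {ffun 'I_K -> 'I_B}) :
  ((alo ^+ 2 * (alpha ^+ 2 * \sum_(b < K) (u b != v b)%:R))%:E <=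
   \int[PX]_x ((hyp u x - hyp v x) ^+ 2)%:E)%E.
Proof.
set theta := block_sparse idx alpha u - block_sparse idx alpha v.
have sparse : (l0norm theta <= minn (2 * k) M)%N.
  rewrite leq_min; apply/andP; split; last first.
    by rewrite -[leqRHS]card_ord; exact: max_card.
  apply: leq_trans (l0norm_sub _ _) _.
  rewrite mul2n -addnn; apply: leq_add; apply: leq_trans Kk.
    exact: l0norm_block_sparse.
  exact: l0norm_block_sparse.
under eq_integral do rewrite -linear_fun_sub.
apply: le_trans (SRC_sqr_ge alo0 src sparse).
by rewrite lee_fin ler_wpM2l ?sqr_ge0//; exact: block_sparse_dist_ge.
Qed.

(** [vhat] picks the hypothesis nearest to the estimate.  The elementary
    inequality [(a - b) ^ 2 <= 2 * (c - a) ^ 2 + 2 * (c - b) ^ 2] and minimality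
    of [vhat] give [|| f_vhat - f_v || ^ 2 <= 4 * || fhat - f_v || ^ 2]. *)
Lemma risk_ge_test_error (v0 : {ffun 'I_K -> 'I_B})
    (fhat : n.-tuple (M.-tuple R * R) -> M.-tuple R -> R) :
  estimator fhat ->
  exists vhat : n.-tuple (M.-tuple R * R) -> {ffun 'I_K -> 'I_B},
    (forall u, measurable (vhat @^-1` [set u])) /\
    forall v, ((alo ^+ 2 * alpha ^+ 2 / 4)%:E *
               \sum_(b < K) P [set w | vhat (sample X eps (hyp v) w) b != v b] <=
               risk PX X eps fhat (hyp v))%E.
Proof.
move=> mfhat.
pose D v (z : n.-tuple (M.-tuple R * R)) : \bar R :=
  (\int[PX]_x ((fhat z x - hyp v x) ^+ 2)%:E)%E.
have mD v : measurable_fun setT (D v).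
  apply: (@measurable_fun_fubini_tonelli_F _ _ _ _ _ PX
    (fun zx => ((fhat zx.1 zx.2 - hyp v zx.2) ^+ 2)%:E)); last first.
    by move=> zx; rewrite lee_fin sqr_ge0.
  apply/measurable_EFinP; apply: measurable_funX; apply: measurable_funB => //.
  apply: (measurableT_comp (measurable_linear_fun _)); exact: measurable_snd.
have [vhat [vmin mvhat]] := measurable_argmin v0 mD.
exists vhat; split => // v.
have riskE : risk PX X eps fhat (hyp v) = (\int[P]_w D v (sample X eps (hyp v) w))%E.
  by apply: eq_integral => w _; exact: L2norm_sqr.
have msample : measurable_fun setT (sample X eps (hyp v)).
  apply: measurable_sample; exact: measurable_linear_fun.
pose E b := [set z | vhat z b != v b].
have mE b : measurable (E b).
  have -> : E b = \bigcup_(u in [set u : {ffun 'I_K -> 'I_B} | u b != v b]) (vhat @^-1` [set u]).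
    apply/seteqP; split => z /=; first by move=> zb; exists (vhat z).
    by move=> [u /= ub zu]; rewrite /E /= zu.
  by apply: fin_bigcup_measurable => [|u _]; [exact: finite_finset|exact: mvhat].
have D_ge z : ((alo ^+ 2 * alpha ^+ 2 / 4 * \sum_(b < K) \1_(E b) z)%:E <= D v z)%E.
  have mf : measurable_fun setT (fhat z).
    exact: (measurableT_comp mfhat (pair1_measurable z)).
  have msq u : measurable_fun setT (fun x => ((fhat z x - hyp u x) ^+ 2)%:E).
    apply/measurable_EFinP; apply: measurable_funX; apply: measurable_funB => //.
    exact: measurable_linear_fun.
  have sq0 u x : (0 <= ((fhat z x - hyp u x) ^+ 2)%:E)%E by rewrite lee_fin sqr_ge0.
  have le4 : (\int[PX]_x ((hyp (vhat z) x - hyp v x) ^+ 2)%:E <= 4%:E * D v z)%E.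
    apply: (@le_trans _ _ (2%:E * D (vhat z) z + 2%:E * D v z)%E).
      rewrite /D -!ge0_integralZl//; do ?by rewrite lee_fin.
      rewrite -ge0_integralD//; last 4 first.
      - by move=> x _; rewrite mule_ge0// lee_fin.
      - exact: emeasurable_funM.
      - by move=> x _; rewrite mule_ge0// lee_fin.
      - exact: emeasurable_funM.
      apply: ge0_le_integral => //.
      - by move=> x _; rewrite lee_fin sqr_ge0.
      - apply/measurable_EFinP; apply: measurable_funX.
        by apply: measurable_funB; exact: measurable_linear_fun.
      - by apply: emeasurable_funD; exact: emeasurable_funM.
      - move=> x _; rewrite -!EFinM -EFinD lee_fin.
        set a := hyp _ x; set b := hyp v x; set c := fhat z x.
        rewrite -subr_ge0; have -> : 2 * (c - a) ^+ 2 + 2 * (c - b) ^+ 2 - (a - b) ^+ 2 =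
          (a + b - 2 * c) ^+ 2 by ring.
        exact: sqr_ge0.
    have -> : (4%:E * D v z = 2%:E * D v z + 2%:E * D v z)%E.
      have Dv0 : (0 <= D v z)%E by apply: integral_ge0.
      by rewrite -ge0_muleDl ?lee_fin// -EFinD; congr (_%:E * _)%E; ring.
    by apply: leeD => //; apply: lee_pmul => //; apply: integral_ge0.
  have := le_trans (hypotheses_separated (vhat z) v) le4.
  rewrite -lee_pdivrMl//.
  apply: le_trans; rewrite -EFinM lee_fin.
  have -> : \sum_(b < K) \1_(E b) z = \sum_(b < K) (vhat z b != v b)%:R :> R.
    apply: eq_bigr => b _; rewrite indicE; congr (_%:R); congr nat_of_bool.
    by apply/idP/idP; rewrite inE.
  by rewrite le_eqVlt; apply/orP; left; apply/eqP; field.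
rewrite riskE.
have c0 : 0 <= alo ^+ 2 * alpha ^+ 2 / 4.
  by rewrite mulr_ge0// mulr_ge0// sqr_ge0.
have mEs b : measurable (sample X eps (hyp v) @^-1` E b).
  by rewrite -[X in measurable X]setTI; exact: msample.
have PE : (\sum_(b < K) P [set w | vhat (sample X eps (hyp v) w) b != v b] =
    \int[P]_w (\sum_(b < K) \1_(E b) (sample X eps (hyp v) w))%:E)%E.
  under [RHS]eq_integral do rewrite -sumEFin.
  rewrite ge0_integral_sum//; last first.
    move=> b; apply/measurable_EFinP.
    by apply: measurableT_comp => //; exact: measurable_indic.
  apply: eq_bigr => b _.
  rewrite -[LHS]/(P (sample X eps (hyp v) @^-1` E b)).
  by rewrite -[in LHS](setIT (_ @^-1` E b)) -integral_indic.
rewrite PE -ge0_integralZl//; last 2 first.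
- apply/measurable_EFinP; apply: measurable_sum => b.
  by apply: measurableT_comp => //; exact: measurable_indic.
- by move=> w _; rewrite lee_fin sumr_ge0.
apply: ge0_le_integral => //.
- by move=> w _; rewrite -EFinM lee_fin mulr_ge0// sumr_ge0.
- apply/measurable_EFinP; apply: measurable_funM => //; apply: measurable_sum => b.
  by apply: measurableT_comp => //; exact: measurable_indic.
- exact: measurableT_comp.
- by move=> w _; rewrite -EFinM; exact: D_ge.
Qed.

End testing_reduction.

(** * Error of every test over the blocks *)

Definition set_block {K B : nat} (v : {ffun 'I_K -> 'I_B}) (b : 'I_K) (j : 'I_B) :
  {ffun 'I_K -> 'I_B} := [ffun b' => if b' == b then j else v b'].

(** [G v j] is the probability of answering [j] for block [b] when it depends on
    [v] only outside [b].  Exchanging the content of the block with the answer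
    is an involution on the pairs [(v, j)], so the average of [G v (v b)] over
    [v] equals the average of [G v j] over [v] and [j]. *)
Lemma sum_guess_le {R : realType} {K B : nat} (b : 'I_K)
    (G : {ffun 'I_K -> 'I_B} -> 'I_B -> R) :
  (forall v i j, G (set_block v b i) j = G v j) ->
  (forall v, \sum_(j < B) G v j <= 1) ->
  B%:R * \sum_v G v (v b) <= #|{ffun 'I_K -> 'I_B}|%:R.
Proof.
move=> Gb G1.
have -> : B%:R * \sum_v G v (v b) =
    \sum_(p : {ffun 'I_K -> 'I_B} * 'I_B) G p.1 (p.1 b).
  rewrite -(pair_big predT predT (fun (v : {ffun 'I_K -> 'I_B}) (j : 'I_B) => G v (v b))) /=.
  rewrite mulr_sumr; apply: eq_bigr => v _.
  by rewrite sumr_const card_ord mulr_natl.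
pose h (p : {ffun 'I_K -> 'I_B} * 'I_B) := (set_block p.1 b p.2, p.1 b).
have hK : involutive h.
  move=> [v j]; rewrite /h /=; congr pair; last by rewrite ffunE eqxx.
  by apply/ffunP => b'; rewrite !ffunE; case: eqP => // ->.
rewrite (reindex_inj (inv_inj hK)) /=.
rewrite (eq_bigr (fun p : {ffun 'I_K -> 'I_B} * 'I_B => G p.1 p.2)); last first.
  by move=> [v j] _ /=; rewrite Gb ffunE eqxx.
rewrite -(pair_big predT predT (fun (v : {ffun 'I_K -> 'I_B}) (j : 'I_B) => G v j)) /=.
apply: le_trans (ler_sum _ (fun v _ => G1 v)) _.
by rewrite sumr_const.
Qed.

Section block_minimax.
Context {d} {Omega : measurableType d} {R : realType} (P : probability Omega R).
Context {n M K B : nat} (PX : probability (M.-tuple R) R) (sigma : R).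
Variables (X : 'I_n -> {RV P >-> M.-tuple R}) (eps : 'I_n -> {RV P >-> R}).
Hypotheses (design : regression_design PX sigma X eps) (sigma0 : 0 < sigma).
Variables (alo ahi : R) (k : nat).
Hypotheses (alo0 : 0 < alo) (src : SRC PX alo ahi k).
Variables (idx : 'I_K * 'I_B -> 'I_M) (idx_inj : injective idx).
Hypotheses (K0 : (0 < K)%N) (Kk : (K <= k)%N) (B1 : (1 < B)%N).
Variable alpha : R.
Hypothesis small : n%:R * (ahi ^+ 2 * alpha ^+ 2) <= sigma ^+ 2 * ln B%:R / 40.

Local Notation hyp v := (linear_fun (block_sparse idx alpha v)).

Let B0 : 0 < B%:R :> R. Proof. by rewrite ltr0n ltnW. Qed.
Let lnB : 0 < ln B%:R :> R. Proof. by rewrite ln_gt0// ltr1n. Qed.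

(** [Y = B ^ (1/4)]: the comparison is used with [r = ln B / 4], so that
    [expR r = Y], and with [c = sqrt B = Y ^ 2]. *)
Let Y : R := expR (ln B%:R / 4).
Let Y0 : 0 < Y. Proof. exact: expR_gt0. Qed.
Let Y4 : Y ^+ 4 = B%:R.
Proof.
rewrite -expRM_natl (_ : 4%:R * (ln B%:R / 4) = ln B%:R); last by field.
by rewrite lnK.
Qed.

Let Y_budget : expR (ln B%:R / 4) / (2 * Y ^+ 2) + Y ^+ 2 / 2 / B%:R <= 4 / 5.
Proof.
(* [Y ^ 4 >= 2 > 1.18 ^ 4]; the decreasing function [1 / Y + 1 / Y ^ 2] is
   below [8 / 5] at [Y = 1.18]. *)
have Yge : 118 / 100 <= Y.
  rewrite leNgt; apply/negP => Ylt.
  have : Y ^+ 4 < (118 / 100) ^+ 4 by rewrite ltr_pXn2r// nnegrE ?ltW.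
  have B2 : (2 : R) <= B%:R by rewrite ler_nat.
  by rewrite Y4; lra.
rewrite -/Y -Y4.
have -> : Y / (2 * Y ^+ 2) + Y ^+ 2 / 2 / Y ^+ 4 = (Y + 1) / (2 * Y ^+ 2).
  by field; rewrite gt_eqF.
rewrite ler_pdivrMr ?mulr_gt0 ?exprn_gt0//; nra.
Qed.

(** The probability [p v b] of a correct answer in block [b] is compared with the
    probability [q v b j] of the answer [j] when block [b] has been erased from
    the regression function ([base v b]).  The truncation costs at most 1/10 by
    Markov, the two other terms at most 4/5 on average over [v], so some [v]
    has on average over the blocks at least one error in ten. *)
Lemma block_minimax_lower (fhat : n.-tuple (M.-tuple R * R) -> M.-tuple R -> R) :
  estimator fhat ->
  exists v, ((alo ^+ 2 * (alpha ^+ 2 * K%:R) / 40)%:E <=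
             risk PX X eps fhat (hyp v))%E.
Proof.
move=> est.
pose v0 : {ffun 'I_K -> 'I_B} := [ffun=> Ordinal (ltnW B1)].
have [vhat [mvhat risk_ge]] := risk_ge_test_error X eps alo0 src idx_inj Kk alpha v0 est.
pose base (v : {ffun 'I_K -> 'I_B}) b (x : M.-tuple R) :=
  \sum_(b' < K | b' != b) alpha * tnth x (idx (b', v b')).
pose A b j := [set z | vhat z b = j].
have mA b j : measurable (A b j).
  have -> : A b j = \bigcup_(u in [set u : {ffun 'I_K -> 'I_B} | u b = j]) (vhat @^-1` [set u]).
    apply/seteqP; split => z /=; first by move=> zb; exists (vhat z).
    by move=> [u /= ub zu]; rewrite /A /= zu.
  by apply: fin_bigcup_measurable => [|u _]; [exact: finite_finset|exact: mvhat].
have mbase v b : measurable_fun setT (base v b).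
  rewrite /base; under eq_fun do rewrite -big_filter.
  apply: measurable_sum => b'; apply: measurable_funM => //.
  exact: measurable_tnth.
have mS (f : M.-tuple R -> R) b j : measurable_fun setT f ->
    measurable [set w | A b j (sample X eps f w)].
  move=> mf; rewrite -[X in measurable X]setTI.
  exact: (measurable_sample X eps mf).
have mhyp (v : {ffun 'I_K -> 'I_B}) : measurable_fun setT (hyp v).
  exact: measurable_linear_fun.
pose p (v : {ffun 'I_K -> 'I_B}) b := fine (P [set w | A b (v b) (sample X eps (hyp v) w)]).
pose q (v : {ffun 'I_K -> 'I_B}) b j := fine (P [set w | A b j (sample X eps (base v b) w)]).
have p_le v b : p v b <= 1 / 10 + Y ^+ 2 / 2 * q v b (v b) +
    expR (ln B%:R / 4) / (2 * Y ^+ 2).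
  pose e := alpha *: delta_mx ord0 (idx (b, v b)) : 'rV[R]_M.
  have hypE : hyp v = base v b \+ linear_fun e.
    apply/funext => x; rewrite linear_fun_block_sparse//= linear_fun_delta.
    by rewrite (bigD1 b)//= addrC.
  have esparse : (l0norm e <= minn (2 * k) M)%N.
    apply: leq_trans (l0norm_delta _ _) _.
    rewrite leq_min muln_gt0 (leq_trans K0 Kk) /=.
    exact: leq_ltn_trans (ltn_ord (idx (b, v b))).
  have eV := SRC_sqr_le src esparse.
  rewrite sum_sqr_delta in eV.
  have t0 : 0 < ln B%:R / 4 * sigma ^+ 2 by rewrite mulr_gt0 ?exprn_gt0 ?divr_gt0.
  have tail := design_sum_markov design (measurable_linear_fun e) t0 eV.
  have c0 : 0 < Y ^+ 2 by rewrite exprn_gt0.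
  have := sample_shift_prob_le design sigma0 (ln B%:R / 4) (mbase v b)
    (measurable_linear_fun e) (mA b (v b)) c0.
  rewrite -hypE => le1.
  rewrite -lee_fin /p fineK; last by apply: fin_num_measure; exact: mS.
  apply: (le_trans le1); rewrite !EFinD; apply: leeD => //; apply: leeD; last first.
    by rewrite /q [leRHS]EFinM fineK//; apply: fin_num_measure; exact: mS.
  apply: (le_trans tail); rewrite lee_fin ler_pdivrMr//.
  by apply: le_trans small _; rewrite le_eqVlt; apply/orP; left; apply/eqP; field.
have q_sum v b : \sum_(j < B) q v b j <= 1.
  rewrite /q -lee_fin -sumEFin.
  under eq_bigr do (rewrite fineK; last by apply: fin_num_measure; exact: mS).
  rewrite -(measure_bigsetU_ord P xpredT (F := fun j => [set w | A b j (sample X eps (base v b) w)])).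
  - apply: probability_le1; apply: bigsetU_measurable => j _; exact: mS.
  - by move=> j; exact: mS.
  - by move=> i j _ _ [w [/= <- <-]].
have avg : \sum_v \sum_(b < K) p v b <= 9 / 10 * K%:R * #|{ffun 'I_K -> 'I_B}|%:R.
  rewrite exchange_big /= (_ : 9 / 10 * K%:R * _ =
    \sum_(b < K) 9 / 10 * #|{ffun 'I_K -> 'I_B}|%:R); last first.
    by rewrite sumr_const card_ord -mulr_natr; ring.
  apply: ler_sum => b _.
  apply: (le_trans (ler_sum _ (fun v _ => p_le v b))).
  rewrite !big_split /= !sumr_const -mulr_sumr.
  have : B%:R * \sum_v q v b (v b) <= #|{ffun 'I_K -> 'I_B}|%:R.
    apply: (sum_guess_le (G := fun v j => q v b j)) => // v i j; rewrite /q; congr (fine (P _)).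
    rewrite (_ : base (set_block v b i) b = base v b)//.
    apply/funext => x; apply: eq_bigr => b' b'b.
    by rewrite ffunE (negbTE b'b).
  set N := #|_|%:R; set Q := \sum_v _ => BQ.
  rewrite -[X in X + _ + _]mulr_natr -[X in _ + X]mulr_natr -/N.
  have N0 : 0 <= N by exact: ler0n.
  have Q_le : Y ^+ 2 / 2 * Q <= Y ^+ 2 / 2 / B%:R * N.
    rewrite -[leRHS]mulrA ler_wpM2l//; first by rewrite divr_ge0// exprn_ge0// ltW.
    by rewrite mulrC ler_pdivlMr// mulrC.
  have := ler_wpM2r N0 Y_budget; rewrite mulrDl; lra.
have [v vP] : exists v, \sum_(b < K) p v b <= 9 / 10 * K%:R.
  apply: contrapT => /forallNP no.
  have : \sum_(v : {ffun 'I_K -> 'I_B}) 9 / 10 * K%:R < \sum_v \sum_(b < K) p v b.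
    apply: ltr_sum; first by apply/hasP; exists v0 => //; rewrite mem_index_enum.
    by move=> v _; rewrite ltNge; apply/negP/no.
  by move=> /lt_le_trans/(_ avg); rewrite sumr_const -[X in X < _]mulr_natr ltxx.
exists v; apply: le_trans (risk_ge v).
have -> : (\sum_(b < K) P [set w | vhat (sample X eps (hyp v) w) b != v b] =
    (\sum_(b < K) (1 - p v b))%:E)%E.
  rewrite -sumEFin; apply: eq_bigr => b _.
  have -> : [set w | vhat (sample X eps (hyp v) w) b != v b] =
      ~` [set w | A b (v b) (sample X eps (hyp v) w)].
    by apply/seteqP; split => w /=; [move/eqP|move/eqP].
  rewrite probability_setC; last exact: mS.
  rewrite EFinB /p fineK//; apply: fin_num_measure; exact: mS.
rewrite -EFinM lee_fin.
have c0 : 0 <= alo ^+ 2 * alpha ^+ 2 / 4 by rewrite mulr_ge0// mulr_ge0// sqr_ge0.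
apply: le_trans (ler_wpM2l c0 (_ : K%:R / 10 <= _)).
  by rewrite le_eqVlt; apply/orP; left; apply/eqP; field.
by rewrite sumrB sumr_const card_ord; lra.
Qed.

End block_minimax.

(** * Minimax lower bound for a sparse class *)

(** [K = min k (M / 2)] blocks of [M / K] coordinates: halving [M] guarantees at
    least two positions per block, at the price of a factor 3 in [K]. *)
Lemma block_index {k M : nat} : (0 < k <= M)%N -> (1 < M)%N ->
  exists K B, [/\ (0 < K <= k)%N, (k <= 3 * K)%N, (1 < B)%N,
    (K * B <= M)%N & (M <= 2 * B * K)%N].
Proof.
move=> /andP[k0 kM] M1; have K0 : (0 < minn k M./2)%N by lia.
exists (minn k M./2), (M %/ minn k M./2)%N; split.
- by rewrite K0 geq_minl.
- have := odd_double_half M; case: (odd M) => /=; lia.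
- by rewrite leq_divRL//; lia.
- by rewrite mulnC leq_divM.
- have := ltn_ceil M K0; have : (0 < M %/ minn k M./2)%N by rewrite divn_gt0//; lia.
  nia.
Qed.

Lemma grid_index {K B M : nat} : (K * B <= M)%N ->
  exists idx : 'I_K * 'I_B -> 'I_M, injective idx.
Proof.
move=> KBM.
have lt (p : 'I_K * 'I_B) : (p.1 * B + p.2 < M)%N.
  by apply: leq_trans KBM; case: p => [[b bK] [j jB]] /=; nia.
exists (fun p => Ordinal (lt p)) => -[b j] [b' j'] [e].
have B0 : (0 < B)%N by apply: leq_ltn_trans (ltn_ord j).
congr pair; apply: val_inj => /=.
  by move/(congr1 (divn^~ B)): e; rewrite !divnMDl// !divn_small// !addn0.
by move/(congr1 (modn^~ B)): e; rewrite !modnMDl !modn_small.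
Qed.

Lemma ln2_ge_half {R : realType} : 1 / 2 <= ln 2 :> R.
Proof.
have : ln (1 + - (1 / 2)) <= - (1 / 2) :> R by apply: le_ln1Dx; lra.
have -> : 1 + - (1 / 2) = 2^-1 :> R by field.
by rewrite lnV ?posrE//; lra.
Qed.

Definition two_valued {R : realType} {M : nat} (a : R) (theta : 'rV[R]_M) : Prop :=
  forall i, theta ord0 i = 0 \/ theta ord0 i = a.

Lemma sum_two_valued {R : realType} {M : nat} (a : R) (theta : 'rV[R]_M) (phi : R -> R) :
  two_valued a theta -> phi 0 = 0 ->
  \sum_(i < M) phi (theta ord0 i) = (l0norm theta)%:R * phi a.
Proof.
move=> val phi0; rewrite (bigID (fun i => theta ord0 i != 0)) /= [X in _ + X]big1; last first.
  by move=> i; rewrite negbK => /eqP ->.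
rewrite addr0 (eq_bigr (fun=> phi a)) ?sumr_const ?mulr_natl// => i.
by case: (val i) => ->; rewrite ?eqxx.
Qed.

Lemma block_sparse_two_valued {R : realType} {M K B : nat}
    (idx : 'I_K * 'I_B -> 'I_M) (idx_inj : injective idx) (a : R) v :
  two_valued a (block_sparse idx a v).
Proof.
move=> i; rewrite mxE; have [/existsP[b /eqP bi]|nb] := boolP [exists b, idx (b, v b) == i].
  right; rewrite (bigD1 b)//= bi eqxx big1 ?addr0// => b' b'b; rewrite -bi.
  by rewrite (inj_eq idx_inj) xpair_eqE (negbTE b'b).
left; rewrite big1// => b _; case: ifP => // bi.
by case/negP: nb; apply/existsP; exists b.
Qed.

Section sparse_minimax.
Context {d} {Omega : measurableType d} {R : realType} (P : probability Omega R).
Context {n M : nat} (PX : probability (M.-tuple R) R) (sigma : R).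
Variables (X : 'I_n -> {RV P >-> M.-tuple R}) (eps : 'I_n -> {RV P >-> R}).
Hypotheses (design : regression_design PX sigma X eps) (sigma0 : 0 < sigma).
Variables (alo ahi : R) (k : nat).
Hypotheses (alo0 : 0 < alo) (ahi0 : 0 < ahi) (src : SRC PX alo ahi k).
Hypotheses (n0 : (0 < n)%N) (M1 : (1 < M)%N) (kM : (0 < k <= M)%N).

(** The class enters only through the two-valued sparse parameters that it
    contains.  Since [1 + ln (M / k) <= 4 * ln B], the condition on [a] is the
    one of [block_minimax_lower] with [40 * 4 = 160], and [40 * 3 = 120] is due
    to [k <= 3 * K]. *)
Lemma two_valued_minimax_lower (F : set (M.-tuple R -> R)) (a : R) :
  (forall theta, two_valued a theta -> (l0norm theta <= k)%N -> F (linear_fun theta)) ->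
  n%:R * (ahi ^+ 2 * a ^+ 2) <= sigma ^+ 2 * (1 + ln (M%:R / k%:R)) / 160 ->
  ((alo ^+ 2 * (a ^+ 2 * k%:R) / 120)%:E <= minimax_risk PX X eps F)%E.
Proof.
move=> FP small; have /andP[k0 kleM] := kM.
have [K [B [/andP[K0 Kk] k3K B1 KBM M2BK]]] := block_index kM M1.
have [idx idx_inj] := grid_index KBM.
have B0 : 0 < B%:R :> R by rewrite ltr0n ltnW.
have lnB : 1 + ln (M%:R / k%:R) <= 4 * ln B%:R :> R.
  have B2 : ln 2 <= ln B%:R :> R by rewrite ler_ln ?posrE// ler_nat.
  have le1 : ln (M%:R / k%:R) <= ln (2 * B%:R) :> R.
    have M0 : 0 < M%:R :> R by rewrite ltr0n ltnW.
    have k0R : 0 < k%:R :> R by rewrite ltr0n.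
    rewrite ler_ln ?posrE ?divr_gt0 ?mulr_gt0//.
    rewrite ler_pdivrMr ?ltr0n// -!natrM ler_nat.
    by apply: leq_trans M2BK _; rewrite leq_mul2l Kk orbT.
  have := @ln2_ge_half R; rewrite lnM ?posrE// in le1; lra.
have small' : n%:R * (ahi ^+ 2 * a ^+ 2) <= sigma ^+ 2 * ln B%:R / 40.
  apply: (le_trans small).
  have -> : sigma ^+ 2 * ln B%:R / 40 = sigma ^+ 2 * (4 * ln B%:R) / 160 by field.
  by rewrite ler_pM2r// ler_wpM2l// sqr_ge0.
apply: le_ereal_inf_tmp => _ [fhat est <-].
have [v le_risk] := block_minimax_lower design sigma0 alo0 src idx_inj K0 Kk B1 small' est.
apply: (@le_trans _ _ (risk PX X eps fhat (linear_fun (block_sparse idx a v)))).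
  apply: le_trans le_risk; rewrite lee_fin.
  have : (k%:R : R) <= 3 * K%:R by rewrite -natrM ler_nat.
  move=> k3.
  have := ler_wpM2l (mulr_ge0 (sqr_ge0 alo) (sqr_ge0 a)) k3; lra.
apply: ereal_sup_ubound; exists (linear_fun (block_sparse idx a v)) => //.
apply: FP; first exact: block_sparse_two_valued.
by apply: leq_trans Kk; exact: l0norm_block_sparse.
Qed.

(** Take the largest level allowed both by indistinguishability and by the
    radius [rho] up to which the class contains two-valued parameters. *)
Lemma sparse_minimax_lower (F : set (M.-tuple R -> R)) (rho : R) : 0 < rho ->
  (forall a theta, 0 < a <= rho -> two_valued a theta -> (l0norm theta <= k)%N ->
    F (linear_fun theta)) ->
  ((alo ^+ 2 / 120 * Num.min (160 * ahi ^+ 2)^-1 1 *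
    Num.min (sigma ^+ 2 * sparse_rate n M k) (k%:R * rho ^+ 2))%:E
   <= minimax_risk PX X eps F)%E.
Proof.
move=> rho0 FP; have /andP[k0 kleM] := kM.
have k0R : 0 < k%:R :> R by rewrite ltr0n.
have n0R : 0 < n%:R :> R by rewrite ltr0n.
have s2 : 0 < sigma ^+ 2 by rewrite exprn_gt0.
have lnMk : 0 <= ln (M%:R / k%:R) :> R.
  by rewrite ln_ge0// ler_pdivlMr// mul1r ler_nat.
pose A := sigma ^+ 2 * (1 + ln (M%:R / k%:R)) / (160 * (n%:R * ahi ^+ 2)).
have A0 : 0 < A.
  by rewrite /A divr_gt0// ?mulr_gt0// ?exprn_gt0//; lra.
pose a := Num.sqrt (Num.min A (rho ^+ 2)).
have min0 : 0 < Num.min A (rho ^+ 2) by rewrite lt_min A0 exprn_gt0.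
have a2 : a ^+ 2 = Num.min A (rho ^+ 2) by rewrite sqr_sqrtr// ltW.
have a0 : 0 < a by rewrite sqrtr_gt0.
have arho : a <= rho.
  rewrite -[leRHS]gtr0_norm// -sqrtr_sqr; apply: ler_wsqrtr.
  by rewrite ge_min lexx orbT.
apply: le_trans (@two_valued_minimax_lower F a _ _); last 2 first.
- by move=> theta val sp; apply: FP val sp; rewrite a0.
- rewrite a2; apply: (@le_trans _ _ (n%:R * (ahi ^+ 2 * A))).
    by rewrite ler_wpM2l ?ler0n// ler_wpM2l ?sqr_ge0// ge_min lexx.
  rewrite le_eqVlt; apply/orP; left; apply/eqP; rewrite /A; field.
  by rewrite !gt_eqF.
rewrite lee_fin a2.
have -> : alo ^+ 2 * (Num.min A (rho ^+ 2) * k%:R) / 120 =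
  alo ^+ 2 / 120 * (Num.min A (rho ^+ 2) * k%:R) by ring.
rewrite -mulrA ler_wpM2l ?divr_ge0 ?sqr_ge0//.
have Ak : A * k%:R = (160 * ahi ^+ 2)^-1 * (sigma ^+ 2 * sparse_rate n M k).
  by rewrite /A /sparse_rate; field; rewrite !gt_eqF.
have r0 : 0 <= sigma ^+ 2 * sparse_rate n M k.
  apply: mulr_ge0; first exact: ltW.
  apply: divr_ge0; last exact: ltW.
  by apply: mulr_ge0; lra.
have c0 : 0 <= (160 * ahi ^+ 2)^-1 by rewrite invr_ge0 mulr_ge0 ?sqr_ge0.
have krho : 0 <= k%:R * rho ^+ 2 by rewrite mulr_ge0 ?sqr_ge0// ltW.
have -> : Num.min A (rho ^+ 2) * k%:R = Num.min (A * k%:R) (k%:R * rho ^+ 2).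
  by rewrite minr_pMl ?(ltW k0R)// [rho ^+ 2 * _]mulrC.
set u := Num.min _ 1; set v := Num.min (sigma ^+ 2 * _) _.
have u0 : 0 <= u by rewrite le_min c0 ler01.
have v0 : 0 <= v by rewrite le_min r0 krho.
rewrite le_min Ak; apply/andP; split.
  by apply: ler_pM; rewrite // ge_min lexx.
by rewrite -[leRHS]mul1r; apply: ler_pM; rewrite // ge_min lexx orbT.
Qed.

End sparse_minimax.

(** * Norm balls and their rates *)

Lemma l2norm_two_valued {R : realType} {M k : nat} (a r : R) (theta : 'rV[R]_M) :
  (0 < k)%N -> 0 < a <= r / Num.sqrt k%:R -> two_valued a theta ->
  (l0norm theta <= k)%N -> l2norm theta <= r.
Proof.
move=> k0 /andP[a0 ar] val sp.
have k0R : 0 < k%:R :> R by rewrite ltr0n.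
rewrite /l2norm (sum_two_valued (phi := fun x => x ^+ 2) val) ?expr0n//.
apply: (@le_trans _ _ (Num.sqrt (k%:R * a ^+ 2))).
  by apply: ler_wsqrtr; rewrite ler_wpM2r ?sqr_ge0// ler_nat.
rewrite sqrtrM ?ler0n// sqrtr_sqr gtr0_norm// mulrC.
by rewrite -ler_pdivlMr// sqrtr_gt0.
Qed.

Lemma lqnorm_two_valued {R : realType} {M k : nat} (q a t : R) (theta : 'rV[R]_M) :
  (0 < k)%N -> 0 < q -> 0 < a <= t / k%:R `^ q^-1 -> two_valued a theta ->
  (l0norm theta <= k)%N -> lqnorm q theta <= t.
Proof.
move=> k0 q0 /andP[a0 at_] val sp.
have k0R : 0 < k%:R :> R by rewrite ltr0n.
rewrite /lqnorm (sum_two_valued (phi := fun x => `|x| `^ q) val); last first.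
  by rewrite normr0 powR0// gt_eqF.
rewrite gtr0_norm//.
apply: (@le_trans _ _ ((k%:R * a `^ q) `^ q^-1)).
  apply: ge0_ler_powR; rewrite ?invr_ge0 ?nnegrE ?mulr_ge0 ?powR_ge0//; first exact: ltW.
  by rewrite ler_wpM2r ?powR_ge0// ler_nat.
rewrite powRM ?powR_ge0// -powRrM divff ?gt_eqF// powRr1 ?(ltW a0)//.
by rewrite mulrC -ler_pdivlMr// powR_gt0.
Qed.

Lemma nat_ceil_itv {R : realType} (x : R) : 0 < x ->
  [/\ (0 < `|Num.ceil x|)%N, x <= (`|Num.ceil x|%N)%:R :> R &
      (`|Num.ceil x|%N)%:R < x + 1 :> R].
Proof.
move=> x0; have c0 : 0 < Num.ceil x by rewrite ceil_gt0.
have cE : (`|Num.ceil x|%N)%:R = (Num.ceil x)%:~R :> R.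
  by rewrite -[in RHS](gtz0_abs c0) pmulrn.
have /andP[c1 c2] := ceil_itv x.
split; first by rewrite absz_gt0 gt_eqF.
  by rewrite cE.
by rewrite cE -ltrBlDr; rewrite intrB in c1.
Qed.

Lemma minn_lt_left (N a b : nat) :
  (minn (minn N a) b < a -> minn (minn N a) b < b -> minn (minn N a) b = N)%N.
Proof. lia. Qed.

Section lq_rate.
Context {R : realType} (n M : nat) (sigma q t : R).
Hypotheses (n2 : (2 <= n)%N) (M2 : (2 <= M)%N) (sigma0 : 0 < sigma).
Hypotheses (q0 : 0 < q) (q1 : q <= 1) (t0 : 0 < t).

Let E := eff_size n sigma q t.
Let u := m_upper n M sigma q t.
Let m := m_lower n M sigma q t.
Let s := 2 / q.

Let n0R : 0 < n%:R :> R. Proof. by rewrite ltr0n ltnW. Qed.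
Let M0R : 0 < M%:R :> R. Proof. by rewrite ltr0n ltnW. Qed.
Let s2 : 0 < sigma ^+ 2. Proof. by rewrite exprn_gt0. Qed.
Let s_ge2 : 2 <= s. Proof. by rewrite /s ler_pdivlMr// -[leRHS]mulr1 ler_pM2l. Qed.
Let base0 : 0 < n%:R * t ^+ 2 * sigma ^- 2.
Proof. by rewrite !mulr_gt0// ?exprn_gt0// invr_gt0 exprn_gt0. Qed.
Let E0 : 0 < E. Proof. exact: powR_gt0. Qed.
Let qs : q / 2 * s = 1. Proof. by rewrite /s; field; rewrite gt_eqF. Qed.

Let Es : E `^ s = n%:R * t ^+ 2 / sigma ^+ 2.
Proof. by rewrite /E /eff_size -powRrM qs powRr1// ltW. Qed.

Let t2E : t ^+ 2 = sigma ^+ 2 / n%:R * E `^ s.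
Proof. by rewrite Es; field; rewrite !gt_eqF. Qed.

(** In terms of the effective size [E], [t ^ 2 = sigma ^ 2 / n * E ^ (2 / q)]:
    the energy allowed by the lq ball at sparsity [k] depends on [k / E] only,
    up to the factor [sigma ^ 2 * E / n]. *)
Lemma radius_sqrE (k : nat) : (0 < k)%N ->
  k%:R * (t / k%:R `^ q^-1) ^+ 2 = sigma ^+ 2 / n%:R * (k%:R * (E / k%:R) `^ s).
Proof.
move=> k0; have k0R : 0 < k%:R :> R by rewrite ltr0n.
have k2 : (k%:R `^ q^-1) ^+ 2 = k%:R `^ s.
  by rewrite -powR_mulrn ?powR_ge0// -powRrM mulrC.
rewrite expr_div_n t2E k2.
rewrite powRM ?invr_ge0 ?(ltW k0R) ?(ltW E0)// -(powR_inv1 (ltW k0R)) -powRrM mulN1r powRN.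
ring.
Qed.

Let ceilE := nat_ceil_itv E0.
Let u_gt0 : (0 < u)%N.
Proof. by case: ceilE => c0 _ _; rewrite /u /m_upper -/E !leq_min c0 /= (ltnW M2) (ltnW n2). Qed.
Let u_le : (u <= minn M n)%N.
Proof. by rewrite /u /m_upper -minnA geq_minr. Qed.
Let u0R : 0 < u%:R :> R. Proof. by rewrite ltr0n. Qed.
Let E_ge : u%:R - 1 <= E.
Proof.
case: ceilE => _ _ c2; rewrite lerBlDr; apply: le_trans (ltW c2).
by rewrite ler_nat /u /m_upper -minnA geq_minl.
Qed.

Let lam := 1 + ln (M%:R / u%:R) : R.
Let lam1 : 1 <= lam.
Proof.
rewrite /lam lerDl ln_ge0// ler_pdivlMr// mul1r ler_nat.
by apply: leq_trans u_le _; rewrite geq_minl.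
Qed.

Let lam0 : 0 < lam. Proof. exact: lt_le_trans ltr01 lam1. Qed.

Lemma m_lower_gt0 : (0 < m)%N.
Proof.
rewrite /m /m_lower -/u; case: ifP => // _.
have x0 : 0 < u%:R / lam `^ (q / 2).
  by rewrite divr_gt0// powR_gt0.
by case: (nat_ceil_itv x0).
Qed.

Lemma m_lower_le : (m <= u)%N.
Proof.
rewrite /m /m_lower -/u -/lam; case: ifP => // _.
have x0 : 0 < u%:R / lam `^ (q / 2).
  by rewrite divr_gt0// powR_gt0.
have ceil0 : 0 < Num.ceil (u%:R / lam `^ (q / 2)) by rewrite ceil_gt0.
rewrite -lez_nat (gtz0_abs ceil0) ceil_le_int -pmulrn.
rewrite ler_pdivrMr ?powR_gt0// ler_peMr ?ler0n// -[leLHS](powRr0 lam).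
by apply: ler_powR => //; rewrite divr_ge0// ltW.
Qed.

(** Write [u] for [m_upper], [m] for [m_lower] and [lam = 1 + ln (M / u)].  If
    [u = min M n], then [m = u <= 2 * E] and both terms are at least
    [sigma ^ 2 * m / n] up to constants.  Otherwise [u] is [E] rounded up and [m]
    is [u / lam ^ (q / 2)] rounded up; for this [m] both [m * lam] and
    [m * (E / m) ^ (2 / q)] are at least of order [E * lam ^ (1 - q / 2)] when
    [m > 1].  When [m = 1], [E ^ (2 / q) <= lam], so [t ^ 2] is at most both
    terms. *)
Lemma rate_lq_le :
  rate_lq n M sigma q t <=
  4 `^ s * Num.min (sigma ^+ 2 * sparse_rate n M m) (m%:R * (t / m%:R `^ q^-1) ^+ 2).
Proof.
have m0 := m_lower_gt0; have mu := m_lower_le.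
have m0R : 0 < m%:R :> R by rewrite ltr0n.
have C4 : 4 <= 4 `^ s :> R.
  by apply: le1r_powR; rewrite ?ler1n// (le_trans _ s_ge2)// ler1n.
have C0 : 0 < 4 `^ s :> R by apply: lt_le_trans C4.
have muR : m%:R <= u%:R :> R by rewrite ler_nat.
have mM : m%:R <= M%:R :> R.
  by rewrite ler_nat; apply: leq_trans mu (leq_trans u_le _); rewrite geq_minl.
have lnMm : 0 <= ln (M%:R / m%:R) :> R by rewrite ln_ge0// ler_pdivlMr// mul1r.
rewrite minr_pMr ?(ltW C0)// le_min radius_sqrE// /sparse_rate.
have [uE|uN] := eqVneq u (minn M n).
  have mE : m = u by rewrite /m /m_lower -/u uE eqxx.
  have u2 : 2 <= u%:R :> R by rewrite ler_nat uE leq_min M2 n2.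
  have rateE : rate_lq n M sigma q t <= sigma ^+ 2 * (m%:R / n%:R).
    rewrite /rate_lq -/m; case: eqP => [->|/eqP mn].
      by rewrite divff ?mulr1// gt_eqF.
    have [mM' Mn] : m = M /\ (M < n)%N.
      by move: mn; rewrite mE uE /minn; case: ltnP => // _; rewrite eqxx.
    by rewrite mM' eqxx Mn /= mulrA.
  apply/andP; split; apply: (le_trans rateE).
    have r0 : 0 <= m%:R / n%:R :> R by rewrite divr_ge0// ltW.
    rewrite (_ : 4 `^ s * _ = sigma ^+ 2 * (m%:R / n%:R * (4 `^ s * (1 + ln (M%:R / m%:R))))); last by ring.
    rewrite ler_wpM2l ?(ltW s2)//; apply: ler_peMr => //; apply: mulr_ege1; last by rewrite lerDl.
    by apply: le_trans C4; rewrite ler1n.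
  have r0 : 0 <= m%:R / n%:R :> R by rewrite divr_ge0// ltW.
  rewrite (_ : 4 `^ s * _ = sigma ^+ 2 * (m%:R / n%:R * (4 `^ s * (E / m%:R) `^ s))); last by ring.
  rewrite ler_wpM2l ?(ltW s2)//; apply: ler_peMr => //.
  rewrite -powRM ?divr_ge0 ?(ltW E0) ?(ltW m0R)// -[leLHS](powRr0 (4 * (E / m%:R))).
  apply: ler_powR; last exact: le_trans s_ge2.
  by rewrite mulrA ler_pdivlMr// mE mul1r; move: (E) (u%:R) E_ge u2 => x y; lra.
have u_lt : (u < minn M n)%N by rewrite ltn_neqAle uN u_le.
have [uM un] : (u < M)%N /\ (u < n)%N by apply/andP; rewrite -ltn_min.
have uE : u = `|Num.ceil E|%N.
  exact: minn_lt_left uM un.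
have Eu : E <= u%:R by rewrite uE; case: ceilE.
set l2 := lam `^ (q / 2).
have l20 : 0 < l2 by apply: powR_gt0.
have x0 : 0 < u%:R / l2 by rewrite divr_gt0.
have [_ xm mx] : [/\ (0 < m)%N, u%:R / l2 <= m%:R & m%:R < u%:R / l2 + 1 :> R].
  by rewrite /m /m_lower -/u (negbTE uN) -/lam -/l2; exact: nat_ceil_itv.
have lamm : lam <= 1 + ln (M%:R / m%:R).
  by rewrite lerD2l ler_ln ?posrE ?divr_gt0// ler_pM2l// lef_pV2 ?posrE.
have nmM : (m == M) = false by apply/negbTE; rewrite neq_ltn (leq_ltn_trans mu uM).
have nmn : (m == n) = false by apply/negbTE; rewrite neq_ltn (leq_ltn_trans mu un).
rewrite /rate_lq -/m nmn nmM /= (leq_ltn_trans mu u_lt) andbT.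
have nV0 : 0 < n%:R^-1 :> R by rewrite invr_gt0.
case: ltnP => m1; last first.
  have m_eq1 : m = 1%N by apply/eqP; rewrite eqn_leq m1.
  have us : E `^ s <= lam.
    have ul2 : u%:R <= l2 by move: xm; rewrite m_eq1 ler_pdivrMr// mul1r.
    rewrite -[leRHS]powRr1 ?(ltW lam0)// -qs powRrM -/l2.
    apply: ge0_ler_powR; rewrite ?nnegrE ?(ltW E0) ?(ltW l20)//.
      exact: le_trans s_ge2.
    exact: le_trans Eu ul2.
  have t2C x : t ^+ 2 <= x -> Num.min (sigma ^+ 2) (t ^+ 2) <= 4 `^ s * x.
    move=> tx; rewrite ge_min; apply/orP; right; apply: (le_trans tx).
    apply: ler_peMl; first exact: le_trans (sqr_ge0 t) tx.
    by apply: le_trans C4; rewrite ler1n.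
  apply/andP; split; apply: t2C; rewrite t2E.
    rewrite -mulrA ler_wpM2l ?(ltW s2)// mulrC ler_pM2r// m_eq1 mul1r -m_eq1.
    exact: le_trans us lamm.
  by rewrite m_eq1 mul1r divr1.
pose e := 1 - q / 2.
have e0 : 0 <= e by rewrite /e subr_ge0 ler_pdivrMr// mul1r (le_trans q1)// ler1n.
have e1 : e <= 1 by rewrite /e gerBl divr_ge0// ltW.
have lamE : lam = l2 * lam `^ e.
  rewrite /l2 -powRD; last by rewrite (gt_eqF lam0) implybT.
  by rewrite /e addrC subrK powRr1// ltW.
have le0 : 0 < lam `^ e by apply: powR_gt0.
have u2 : 2 <= u%:R :> R by rewrite ler_nat (leq_trans m1 mu).
have E_half : u%:R / 2 <= E by move: (E) (u%:R) E_ge u2 => x y; lra.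
(* [G] separates: up to constants, the rate is below it and both terms are
   above it. *)
pose G := sigma ^+ 2 * (E * lam `^ e / n%:R).
have G0 : 0 < G by rewrite /G !(mulr_gt0, divr_gt0).
pose W := (1 + ln (M%:R / E)).
have lnME : 1 <= W.
  by rewrite /W lerDl ln_ge0// ler_pdivlMr// mul1r (le_trans Eu)// ler_nat ltnW.
have W_le : W <= 2 * lam.
  have : ln (M%:R / E) <= ln (2 * (M%:R / u%:R)) :> R.
    rewrite ler_ln ?posrE ?mulr_gt0 ?divr_gt0// ?invr_gt0//.
    rewrite ler_pdivrMr//; move: E_half; rewrite ler_pdivrMr// => h.
    rewrite (_ : 2 * (M%:R / u%:R) * E = M%:R * (E * 2) / u%:R); last by ring.
    by rewrite ler_pdivlMr// ler_pM2l.
  have lam1' : 0 <= ln (M%:R / u%:R) :> R by move: lam1; rewrite /lam lerDl.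
  have ln2_le : ln 2 <= 1 :> R.
    by have := @le_ln1Dx R 1; rewrite (_ : 1 + 1 = 2 :> R); [apply; lra|ring].
  rewrite [ln (2 * _)]lnM ?posrE ?divr_gt0// => h; rewrite /W /lam.
  by move: (ln (M%:R / E)) (ln (M%:R / u%:R)) (ln 2) h lam1' ln2_le => x y z; lra.
have rate_le : Num.min (sigma `^ (2 - q) * t `^ q * (W / n%:R) `^ (1 - q / 2))
    (sigma ^+ 2) <= 2 * G.
  rewrite ge_min; apply/orP; left.
  have EE : E = n%:R `^ (q / 2) * t `^ q / sigma `^ q.
    have sqp (x : R) : 0 < x -> (x ^+ 2) `^ (q / 2) = x `^ q.
      move=> x1; rewrite -powR_mulrn ?(ltW x1)// -powRrM.
      by congr (_ `^ _); field.
    rewrite /E /eff_size powRM ?invr_ge0 ?mulr_ge0 ?ler0n ?(ltW t0) ?(ltW sigma0)//.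
    rewrite powRM ?ler0n ?mulr_ge0 ?(ltW t0)// !sqp//; congr (_ * _).
    by rewrite -(powR_inv1 (ltW s2)) -powRrM mulN1r powRN sqp.
  have -> : (W / n%:R) `^ (1 - q / 2) = W `^ e * (n%:R `^ (q / 2) / n%:R).
    rewrite powRM ?invr_ge0 ?ler0n//; last by apply: le_trans lnME; rewrite ler01.
    rewrite -/e; congr (_ * _).
    rewrite -(powR_inv1 (ltW n0R)) -powRrM -powRD; last by rewrite (gt_eqF n0R) implybT.
    by congr (_ `^ _); rewrite /e; ring.
  have -> : sigma `^ (2 - q) = sigma ^+ 2 / sigma `^ q.
    rewrite powRB; last by rewrite (gt_eqF sigma0) implybT.
    by rewrite powR_mulrn// ltW.
  have We : W `^ e <= 2 * lam `^ e.
    apply: (@le_trans _ _ ((2 * lam) `^ e)).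
      apply: ge0_ler_powR; rewrite ?nnegrE//.
      - by apply: le_trans lnME; rewrite ler01.
      - by rewrite mulr_ge0// ltW.
    rewrite powRM ?(ltW lam0)// ler_wpM2r ?(ltW le0)//.
    by apply: ler1_powR => //; rewrite ler1n.
  have -> : sigma ^+ 2 / sigma `^ q * t `^ q * (W `^ e * (n%:R `^ (q / 2) / n%:R)) =
      sigma ^+ 2 * (E / n%:R) * W `^ e by rewrite EE; ring.
  have -> : 2 * G = sigma ^+ 2 * (E / n%:R) * (2 * lam `^ e) by rewrite /G; ring.
  by rewrite ler_wpM2l// mulr_ge0 ?divr_ge0 ?ltW.
have rate_le4 : Num.min (sigma `^ (2 - q) * t `^ q * (W / n%:R) `^ (1 - q / 2))
    (sigma ^+ 2) <= 4 * G.
  by apply: (le_trans rate_le); rewrite ler_pM2r// ler_nat.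
apply/andP; split; apply: (le_trans rate_le4).
  apply: ler_pM; rewrite ?(ltW G0) ?ler0n//.
  rewrite /G ler_wpM2l ?(ltW s2)// ler_pM2r//.
  apply: (@le_trans _ _ (m%:R * lam)); last by rewrite ler_pM2l.
  rewrite [in leRHS]lamE mulrA ler_pM2r//; apply: (le_trans Eu).
  by rewrite -ler_pdivrMr.
have Em : l2 / 4 <= E / m%:R.
  rewrite ler_pdivlMr// mulrAC ler_pdivrMr//.
  have m2x : m%:R <= 2 * (u%:R / l2).
    have : (2 : R) <= m%:R by rewrite ler_nat.
    by move: (m%:R) (u%:R / l2) mx => x y; lra.
  move: m2x; rewrite mulrA ler_pdivlMr// mulrC => h; apply: (le_trans h).
  by move: (E) (u%:R) E_half => x y; lra.
have pow_ge : lam `^ e * (4 / 4 `^ s) <= (E / m%:R) `^ (s - 1).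
  have s1 : 0 <= s - 1 by rewrite subr_ge0 (le_trans _ s_ge2)// ler1n.
  apply: (@le_trans _ _ ((l2 / 4) `^ (s - 1))); last first.
    by apply: ge0_ler_powR; rewrite ?nnegrE ?divr_ge0 ?(ltW l20) ?(ltW E0) ?ler0n.
  rewrite powRM ?(ltW l20) ?invr_ge0// /l2 -powRrM.
  have -> : q / 2 * (s - 1) = e by rewrite mulrBr qs mulr1.
  rewrite ler_wpM2l ?(ltW le0)// -(@powR_inv1 R 4)// -powRrM mulN1r opprB.
  rewrite powRB; last by rewrite pnatr_eq0 implybT.
  by rewrite powRr1.
have -> : (E / m%:R) `^ s = E / m%:R * (E / m%:R) `^ (s - 1).
  by rewrite mulr_powRB1 ?divr_ge0 ?(ltW E0) ?ler0n//; apply: lt_le_trans s_ge2.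
have -> : 4 `^ s * (sigma ^+ 2 / n%:R * (m%:R * (E / m%:R * (E / m%:R) `^ (s - 1)))) =
    sigma ^+ 2 * (E / n%:R) * (4 `^ s * (E / m%:R) `^ (s - 1)).
  by field; rewrite !gt_eqF.
have -> : 4 * G = sigma ^+ 2 * (E / n%:R) * (4 `^ s * (lam `^ e * (4 / 4 `^ s))).
  by rewrite /G; field; rewrite !gt_eqF.
rewrite ler_wpM2l ?ler_pM2l//.
by rewrite mulr_ge0 ?divr_ge0 ?(ltW s2) ?(ltW E0) ?ler0n.
Qed.

End lq_rate.

(** * Lower bound for the lq balls *)

Lemma rate_lq_ge0 {R : realType} (n M : nat) (sigma q t : R) :
  0 <= rate_lq n M sigma q t.
Proof.
rewrite /rate_lq; case: ifP => _; first exact: sqr_ge0.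
case: ifP => _; first by rewrite divr_ge0// mulr_ge0// sqr_ge0.
case: ifP => _; rewrite le_min ?sqr_ge0 ?andbT//.
by rewrite !mulr_ge0// powR_ge0.
Qed.

(** [k * rho ^ 2 = t ^ 2 * k ^ (1 - 2 / q)], with a nonpositive exponent of [k]. *)
Lemma radius_sqr_le {R : realType} (k m : nat) (q t : R) :
  0 < q <= 1 -> 0 < t -> (0 < k <= m)%N ->
  m%:R * (t / m%:R `^ q^-1) ^+ 2 <= k%:R * (t / k%:R `^ q^-1) ^+ 2.
Proof.
move=> /andP[q0 q1] t0 /andP[k0 km]; have m0 := leq_trans k0 km.
have sg : 1 <= 2 / q by rewrite ler_pdivlMr//; lra.
have E0 : 0 < eff_size 2 1 q t.
  by apply: powR_gt0; rewrite !mulr_gt0// ?exprn_gt0 ?invr_gt0 ?exprn_gt0.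
(* Any sample size and noise level serve to display the exponent of [k]. *)
rewrite !(@radius_sqrE R 2 1 q t _ ltr01 q0 t0)//.
move: (eff_size _ _ _ _) (2 / q) E0 sg => E s E0 sg.
have pull (i : nat) : (0 < i)%N ->
    i%:R * (E / i%:R) `^ s = E * (E / i%:R) `^ (s - 1).
  move=> i0; rewrite -mulr_powRB1 ?divr_ge0 ?(ltW E0)//; last exact: lt_le_trans sg.
  by field; rewrite pnatr_eq0 -lt0n.
rewrite !pull// ler_wpM2l ?divr_ge0 ?sqr_ge0// ler_wpM2l ?(ltW E0)//.
apply: ge0_ler_powR; rewrite ?nnegrE ?subr_ge0 ?divr_ge0 ?(ltW E0)//.
by rewrite ler_pM2l// lef_pV2 ?posrE ?ltr0n// ler_nat.
Qed.

(** For [k] below the effective sparsity, [k * rho ^ 2] is at least its value at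
    [m_lower], which dominates the rate of the ball. *)
Lemma lq_minimax_lower {R : realType} (alo ahi q sigma : R) (n M k : nat) (t : R)
    {d} {Omega : measurableType d} (P : probability Omega R)
    (PX : probability (M.-tuple R) R)
    (X : 'I_n -> {RV P >-> M.-tuple R}) (eps : 'I_n -> {RV P >-> R})
    (F : set (M.-tuple R -> R)) :
  0 < alo -> 0 < ahi -> 0 < q <= 1 -> 0 < sigma ->
  (2 <= n)%N -> (2 <= M)%N -> (1 <= k <= m_lower n M sigma q t)%N -> 0 < t ->
  regression_design PX sigma X eps -> SRC PX alo ahi k ->
  l0_class k `&` lq_class q t `<=` F ->
  ((alo ^+ 2 / 120 * Num.min (160 * ahi ^+ 2)^-1 1 * (4 `^ (2 / q))^-1 *
    Num.min (sigma ^+ 2 * sparse_rate n M k) (rate_lq n M sigma q t))%:E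
   <= minimax_risk PX X eps F)%E.
Proof.
move=> alo0 ahi0 q01 sigma0 n2 M2 /andP[k0 km] t0 design src subF.
have /andP[q0 q1] := q01.
have mM : (m_lower n M sigma q t <= M)%N.
  apply: leq_trans (m_lower_le n2 M2 sigma0 q0 t0) _.
  by rewrite /m_upper minnAC geq_minr.
have kM : (0 < k <= M)%N by rewrite k0 (leq_trans km).
have k0R : 0 < k%:R :> R by rewrite ltr0n.
have rho0 : 0 < t / k%:R `^ q^-1 by rewrite divr_gt0// powR_gt0.
have lower := @sparse_minimax_lower _ _ _ _ _ _ _ _ _ _ design sigma0 _ _ _
  alo0 ahi0 src (ltnW n2) M2 kM F _ rho0.
apply: le_trans (lower _); last first.
  move=> a theta a_rho val sp; apply: subF; split; exists theta => //=.
  exact: (lqnorm_two_valued k0 q0 a_rho val sp).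
have C1 : 1 <= 4 `^ (2 / q) :> R.
  by rewrite -[leLHS](powRr0 4) ler_powR ?ler1n// divr_ge0// ltW.
have C0 : 0 < 4 `^ (2 / q) :> R by apply: lt_le_trans C1.
have c0 : 0 <= alo ^+ 2 / 120 * Num.min (160 * ahi ^+ 2)^-1 1.
  apply: mulr_ge0; first by rewrite divr_ge0// sqr_ge0.
  by rewrite le_min ler01 invr_ge0 mulr_ge0// sqr_ge0.
rewrite lee_fin -mulrA ler_wpM2l// ler_pdivrMl// minr_pMr ?(ltW C0)//.
have r0 : 0 <= sigma ^+ 2 * sparse_rate n M k.
  have /andP[_ kleM] := kM.
  rewrite /sparse_rate mulr_ge0 ?sqr_ge0// divr_ge0// mulr_ge0// addr_ge0// ln_ge0//.
  by rewrite ler_pdivlMr// mul1r ler_nat.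
rewrite le_min !ge_min; apply/andP; split; apply/orP; [left|right].
  exact: ler_peMl.
apply: (le_trans (rate_lq_le n2 M2 sigma0 q0 q1 t0)).
rewrite ler_pM2l// ge_min; apply/orP; right.
by apply: (radius_sqr_le q01 t0); rewrite k0.
Qed.

Theorem theorem5 (R : realType) :
  (* (i) *)
  (forall alo ahi q sigma : R,
     0 < alo -> 0 < ahi -> 0 < q <= 1 -> 0 < sigma ->
   exists c : R, 0 < c /\
   forall (n M : nat) (t : R), (2 <= n)%N -> (2 <= M)%N -> 0 < t ->
   forall (d : measure_display) (Omega : measurableType d)
     (P : probability Omega R) (PX : probability (M.-tuple R) R)
     (X : 'I_n -> {RV P >-> M.-tuple R}) (eps : 'I_n -> {RV P >-> R}),
   regression_design PX sigma X eps ->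
   SRC PX alo ahi (m_lower n M sigma q t) ->
   ((c * rate_lq n M sigma q t)%:E
      <= minimax_risk PX X eps (lq_class q t))%E)
  /\
  (* (ii) *)
  (exists ctilde : R, 0 < ctilde /\
   forall alo ahi sigma : R, 0 < alo -> 0 < ahi -> 0 < sigma ->
   exists c' : R, 0 < c' /\
   forall (n M k : nat) (a : R),
     (2 <= n)%N -> (2 <= M)%N -> (1 <= k <= M)%N -> 0 < a ->
   forall (d : measure_display) (Omega : measurableType d)
     (P : probability Omega R) (PX : probability (M.-tuple R) R)
     (X : 'I_n -> {RV P >-> M.-tuple R}) (eps : 'I_n -> {RV P >-> R}),
   regression_design PX sigma X eps ->
   SRC PX alo ahi k ->
   ((c' * (if ctilde * sigma * Num.sqrt (sparse_rate n M k) <= a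
           then rate_l0 n M sigma k else a ^+ 2))%:E
      <= minimax_risk PX X eps (l0_class k `&` l2_class a))%E)
  /\
  (* (iii) *)
  (forall alo ahi q sigma : R,
     0 < alo -> 0 < ahi -> 0 < q <= 1 -> 0 < sigma ->
   exists c'' : R, 0 < c'' /\
   forall (n M k : nat) (t : R),
     (2 <= n)%N -> (2 <= M)%N -> (1 <= k <= M)%N -> 0 < t ->
   forall (d : measure_display) (Omega : measurableType d)
     (P : probability Omega R) (PX : probability (M.-tuple R) R)
     (X : 'I_n -> {RV P >-> M.-tuple R}) (eps : 'I_n -> {RV P >-> R}),
   regression_design PX sigma X eps ->
   SRC PX alo ahi (minn k (m_lower n M sigma q t)) ->
   ((c'' * rate_lq_l0 n M sigma q t k)%:E
      <= minimax_risk PX X eps (l0_class k `&` lq_class q t))%E).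

Proof.
have c1_gt0 (alo ahi : R) : 0 < alo -> 0 < ahi ->
    0 < alo ^+ 2 / 120 * Num.min (160 * ahi ^+ 2)^-1 1.
  move=> alo0 ahi0; rewrite mulr_gt0 ?divr_gt0 ?exprn_gt0//.
  by rewrite lt_min ltr01 invr_gt0 mulr_gt0 ?exprn_gt0.
have C_ge1 (q : R) : 0 < q -> 1 <= 4 `^ (2 / q) :> R.
  by move=> q0; rewrite -[leLHS](powRr0 4) ler_powR ?ler1n// divr_ge0// ltW.
split; [|split].
- move=> alo ahi q sigma alo0 ahi0 q01 sigma0; have /andP[q0 q1] := q01.
  have C1 := C_ge1 q q0; have C0 : 0 < 4 `^ (2 / q) :> R by apply: lt_le_trans C1.
  have CV0 : 0 < (4 `^ (2 / q))^-1 :> R by rewrite invr_gt0.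
  (* One factor [4 ^ (- 2 / q)] comes from [lq_minimax_lower], the other from
     comparing the sparse rate at [m_lower] with [rate_lq]. *)
  exists (alo ^+ 2 / 120 * Num.min (160 * ahi ^+ 2)^-1 1 *
          (4 `^ (2 / q))^-1 * (4 `^ (2 / q))^-1).
  split; first by rewrite !(mulr_gt0 _ CV0)// c1_gt0.
  move=> n M t n2 M2 t0 d Omega P PX X eps design src.
  have m0 := m_lower_gt0 q n2 M2 sigma0 t0.
  have := @lq_minimax_lower _ _ _ q _ _ _ _ _ _ _ _ _ _ _ (lq_class q t) alo0 ahi0
    q01 sigma0 n2 M2 _ t0 design src (@subIsetr _ _ _).
  rewrite m0 leqnn => /(_ isT); apply: le_trans.
  rewrite lee_fin -mulrA ler_wpM2l//.
    by apply: mulr_ge0; apply: ltW; [exact: c1_gt0|exact: CV0].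
  rewrite ler_pdivrMl// minr_pMr ?(ltW C0)// le_min; apply/andP; split.
    apply: (le_trans (rate_lq_le n2 M2 sigma0 q0 q1 t0)).
    by rewrite ler_pM2l// ge_min lexx.
  by apply: ler_peMl => //; exact: rate_lq_ge0.
(* With constant 1 the two cases are the two sides of the minimum in
   [sparse_minimax_lower]. *)
- exists 1; split=> // alo ahi sigma alo0 ahi0 sigma0.
  exists (alo ^+ 2 / 120 * Num.min (160 * ahi ^+ 2)^-1 1); split; first exact: c1_gt0.
  move=> n M k a n2 M2 kM a0 d Omega P PX X eps design src.
  have /andP[k0 kleM] := kM; have k0R : 0 < k%:R :> R by rewrite ltr0n.
  have sk : 0 < Num.sqrt k%:R :> R by rewrite sqrtr_gt0.
  have rho0 : 0 < a / Num.sqrt k%:R by rewrite divr_gt0.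
  have r0 : 0 <= sparse_rate n M k :> R.
    rewrite /sparse_rate divr_ge0// mulr_ge0// addr_ge0// ln_ge0//.
    by rewrite ler_pdivlMr// mul1r ler_nat.
  have := @sparse_minimax_lower _ _ _ _ _ _ _ _ _ _ design sigma0 _ _ _
    alo0 ahi0 src (ltnW n2) M2 kM (l0_class k `&` l2_class a) _ rho0.
  move=> lower; apply: le_trans (lower _); last first.
    move=> b theta b_rho val sp; split; exists theta => //=.
    exact: (l2norm_two_valued k0 b_rho val sp).
  rewrite lee_fin ler_wpM2l ?(ltW (c1_gt0 _ _ _ _))// mul1r.
  have -> : k%:R * (a / Num.sqrt k%:R) ^+ 2 = a ^+ 2.
    by rewrite expr_div_n sqr_sqrtr ?(ltW k0R)//; field; rewrite gt_eqF.
  have sr0 : 0 <= sigma * Num.sqrt (sparse_rate n M k).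
    by rewrite mulr_ge0 ?sqrtr_ge0// ltW.
  have srE : sigma ^+ 2 * sparse_rate n M k = (sigma * Num.sqrt (sparse_rate n M k)) ^+ 2.
    by rewrite exprMn sqr_sqrtr.
  rewrite le_min /rate_l0; case: ifPn => [le_a|]; last first.
    rewrite -ltNge => /ltW a_le; rewrite lexx andbT srE.
    by rewrite ler_sqr ?nnegrE// ltW.
  have l0_le : sigma ^+ 2 * Num.min 1 (sparse_rate n M k) <=
      sigma ^+ 2 * sparse_rate n M k.
    by rewrite ler_wpM2l ?sqr_ge0// ge_min lexx orbT.
  rewrite l0_le /=; apply: (le_trans l0_le).
  by rewrite srE ler_sqr ?nnegrE// ltW.
- move=> alo ahi q sigma alo0 ahi0 q01 sigma0; have /andP[q0 q1] := q01.
  have C1 := C_ge1 q q0; have C0 : 0 < 4 `^ (2 / q) :> R by apply: lt_le_trans C1.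
  have CV0 : 0 < (4 `^ (2 / q))^-1 :> R by rewrite invr_gt0.
  exists (alo ^+ 2 / 120 * Num.min (160 * ahi ^+ 2)^-1 1 *
          (4 `^ (2 / q))^-1 * (4 `^ (2 / q))^-1).
  split; first by rewrite !(mulr_gt0 _ CV0)// c1_gt0.
  move=> n M k t n2 M2 /andP[k0 kM] t0 d Omega P PX X eps design src.
  have m0 := m_lower_gt0 q n2 M2 sigma0 t0.
  have := @lq_minimax_lower _ _ _ q _ _ _ _ _ _ _ _ _ _ _ (l0_class k `&` lq_class q t)
    alo0 ahi0 q01 sigma0 n2 M2 _ t0 design src _.
  rewrite leq_min k0 m0 geq_minr => /(_ isT) lower; apply: le_trans (lower _); last first.
    move=> f [[theta sp <-] lq]; split => //; exists theta => //=.
    by apply: leq_trans sp _; exact: geq_minl.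
  rewrite lee_fin -mulrA ler_wpM2l//.
    by apply: mulr_ge0; apply: ltW; [exact: c1_gt0|exact: CV0].
  rewrite ler_pdivrMl// /rate_lq_l0 minr_pMr ?(ltW C0)// le_min.
  apply/andP; split; last first.
    by rewrite ge_min; apply/orP; left; apply: ler_peMl => //; exact: rate_lq_ge0.
  have [mk|km] := leqP (m_lower n M sigma q t) k.
    rewrite ge_min; apply/orP; left.
    apply: (le_trans (rate_lq_le n2 M2 sigma0 q0 q1 t0)).
    by rewrite ler_pM2l// ge_min lexx.
  rewrite ge_min; apply/orP; right.
  have r0 : 0 <= sigma ^+ 2 * sparse_rate n M k.
    rewrite mulr_ge0 ?sqr_ge0// /sparse_rate divr_ge0// mulr_ge0// addr_ge0// ln_ge0//.
    by rewrite ler_pdivlMr ?ltr0n// mul1r ler_nat.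
  apply: le_trans (ler_peMl r0 C1).
  by rewrite /rate_l0 ler_wpM2l ?sqr_ge0// ge_min lexx orbT.
Qed.
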